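(* Let $a,b\in\mathbb{P}$, $(\alpha,\beta)\in\mathrm{BP}(a,b)$ and $l\in\mathbb{N}$. If $\alpha=[a]$, then the mapping $\Theta_{(\hat{L},<)}$ induced by the lexicographic ordering pair $(\hat{L},<)$ is a bijection from $\mathrm{VOS}(a,b,[a],\beta,l)$ to $\mathrm{GOT}([a],<,\lambda_{a,b,[a],\beta},l)$, and its inverse is given by $$\hat{\Psi}(t,\eta)=\{(t_1,t_1+\Omega(\eta)_1),\ldots,(t_l,t_l+\Omega(\eta)_l)\}$$ for each $(t,\eta)\in\mathrm{GOT}([a],<,\lambda_{a,b,[a],\beta},l)$. If $\beta=[b]$, then the mapping $\Theta_{(\check{L},>)}$ induced by the antilexicographic ordering pair $(\check{L},>)$ is a bijection from $\mathrm{VOS}(a,b,\alpha,[b],l)$ to $\mathrm{GOT}([b],>,\lambda_{a,b,\alpha,[b]},l)$, and its inverse is given by $$\check{\Psi}(t,\eta)=\{(t_1-\Omega(\eta)_1,t_1),\ldots,(t_l-\Omega(\eta)_l,t_l)\}$$ for each $(t,\eta)\in\mathrm{GOT}([b],>,\lambda_{a,b,\alpha,[b]},l)$.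
   Context: Notation: $\mathbb{P}$ is the set of positive integers, $\mathbb{N}$ the set of nonnegative integers, $[m,n]=\{m,m+1,\ldots,n\}$ ($=\emptyset$ if $n<m$), $[n]=[1,n]$. Osculating paths. For $a,b\in\mathbb{P}$, $[a]\times[b]$ is a rectangle of lattice points with matrix labelling ($(i,j)$ is in row $i$ from the top and column $j$ from the left). $\mathrm{BP}(a,b)$ is the set of pairs $(\alpha,\beta)$ with $\alpha\subset[a]$, $\beta\subset[b]$, $|\alpha|=|\beta|$; elements are labelled in increasing order, $\alpha=\{\alpha_1<\ldots<\alpha_r\}$, $\beta=\{\beta_1<\ldots<\beta_r\}$. For $x\in[a]$, $y\in[b]$, $\Pi(a,b,x,y)$ is the set of paths $Q=(Q_0,\ldots,Q_L)$ with $Q_0=(a,y)$, $Q_L=(x,b)$ and each step $Q_m-Q_{m-1}\in\{(0,1),(-1,0)\}$. For $x<x'$ and $y<y'$, paths $Q\in\Pi(a,b,x,y)$ and $Q'\in\Pi(a,b,x',y')$ are osculating if whenever $Q_m=Q'_{m'}=(i,j)$, then $Q_{m-1}=(i,j-1)$, $Q_{m+1}=(i-1,j)$, $Q'_{m'-1}=(i+1,j)$ (unless $m'=0$) and $Q'_{m'+1}=(i,j+1)$ (unless $Q'_{m'}$ is the last point of $Q'$). $\mathrm{OP}(a,b,\alpha,\beta)$ is the set of $r$-tuples $P=(P_1,\ldots,P_r)$ with $P_k\in\Pi(a,b,\alpha_k,\beta_k)$ and $P_k,P_{k+1}$ osculating for each $k\in[r-1]$. A vacancy of $P$ is a point of $[a]\times[b]$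 on no path of $P$; an osculation of $P$ is a point on two paths of $P$. $Z(P)$ is the set of all vacancies and osculations of $P$. $\mathrm{OP}(a,b,\alpha,\beta,l)$ is the set of $P\in\mathrm{OP}(a,b,\alpha,\beta)$ with $|Z(P)|=l$, and $\mathrm{VOS}(a,b,\alpha,\beta,l)=\{Z(P)\mid P\in\mathrm{OP}(a,b,\alpha,\beta,l)\}$. Partitions. A partition is a weakly decreasing infinite sequence $\lambda=(\lambda_1,\lambda_2,\ldots)$ of nonnegative integers with finitely many nonzero terms; $\ell(\lambda)$ is the number of nonzero terms, $|\lambda|$ the sum, $\lambda^t$ the conjugate, $Y(\lambda)=\{(i,j)\in\mathbb{P}^2\mid i\le\ell(\lambda),\,j\le\lambda_i\}$, and $\emptyset$ is the empty partition. For integers $\gamma_1>\ldots>\gamma_r\ge0$ and $\delta_1>\ldots>\delta_r\ge0$, $(\gamma_1,\ldots,\gamma_r\,|\,\delta_1,\ldots,\delta_r)$ (Frobenius notation) is the unique partition $\lambda$ with exactly $r$ indices $i$ satisfying $\lambda_i\ge i$, and with $\lambda_i-i=\gamma_i$, $\lambda^t_i-i=\delta_i$ for $i\in[r]$. For $\lambda$ with $\ell(\lambda)\le a$ and $\lambda_1\le b$, $[a]\times[b]\setminus\lambda:=(b-\lambda_a,b-\lambda_{a-1},\ldots,b-\lambda_1)$. For $(\alpha,\beta)\in\mathrm{BP}(a,b)$, $\lambda_{a,b,\alpha,\beta}:=[a]\times[b]\setminus(b-\beta_1,\ldots,b-\beta_r\,|\,a-\alpha_1,\ldots,a-\alpha_r)$.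 Partitions $\lambda,\mu$ differ by a square, $\lambda\sim\mu$, if one of $Y(\lambda),Y(\mu)$ is the disjoint union of the other and a single point $(i,j)$; then $\Delta(\lambda,\mu):=j-i$. Oscillating tableaux. $\mathrm{OT}(\lambda,l)$ is the set of sequences $\eta=(\eta_0=\emptyset,\eta_1,\ldots,\eta_l=\lambda)$ of partitions with $\eta_{k-1}\sim\eta_k$ for $k\in[l]$ (shape $\lambda$, length $l$). The profile of $\eta$ is $\Omega(\eta)=(\Omega(\eta)_1,\ldots,\Omega(\eta)_l)$ with $\Omega(\eta)_k=\Delta(\eta_{k-1},\eta_k)$; it determines $\eta$ uniquely. For $T\subset\mathbb{P}$ and a strict total order $\prec$ on $\mathbb{Z}$, $\mathrm{GOT}(T,\prec,\lambda,l)$ is the set of pairs $(t,\eta)\in T^l\times\mathrm{OT}(\lambda,l)$, $t=(t_1,\ldots,t_l)$, such that for each $k\in[l-1]$ either $t_k<t_{k+1}$, or $t_k=t_{k+1}$ and $\Omega(\eta)_k\prec\Omega(\eta)_{k+1}$. Ordering pairs. An ordering pair $(L,\prec)$ is a function $L:\mathbb{P}^2\to\mathbb{P}$ and a strict total order $\prec$ on $\mathbb{Z}$ such that, for all $(i,j),(i',j')\in\mathbb{P}^2$: if $L(i,j)<L(i',j')$, or $L(i,j)=L(i',j')$ and $j-i\prec j'-i'$, then $i<i'$ or $j<j'$. For $S\in\mathrm{VOS}(a,b,\alpha,\beta,l)$, the progression for $S$ induced by $(L,\prec)$ is the unique ordering $s=(s_1,\ldots,s_l)=((i_1,j_1),\ldots,(i_l,j_l))$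 of $S$ such that for each $k\in[l-1]$, $L(i_k,j_k)<L(i_{k+1},j_{k+1})$, or $L(i_k,j_k)=L(i_{k+1},j_{k+1})$ and $j_k-i_k\prec j_{k+1}-i_{k+1}$. There is a unique oscillating tableau $\eta(s)$ of shape $\lambda_{a,b,\alpha,\beta}$ and length $l$ with profile $(j_1-i_1,\ldots,j_l-i_l)$, and $\Theta_{(L,\prec)}(S):=((L(s_1),\ldots,L(s_l)),\eta(s))$. The lexicographic ordering pair is $(\hat{L},<)$ with $\hat{L}(i,j)=i$ and $<$ the usual less-than relation on $\mathbb{Z}$; the antilexicographic ordering pair is $(\check{L},>)$ with $\check{L}(i,j)=j$ and $>$ the usual greater-than relation. *)

(* Defs.v *)
From HB Require Import structures.
From mathcomp Require Import all_boot all_order all_algebra finmap.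
From mathcomp Require Import all_classical.
From mathcomp Require Import zify.

Set Implicit Arguments.
Unset Strict Implicit.
Unset Printing Implicit Defensive.

Import Order.TTheory GRing.Theory Num.Theory.

Local Open Scope fset_scope.
Local Open Scope classical_set_scope.
Local Open Scope ring_scope.

(* Lattice points carry integer coordinates (row, column), so
   that differences j - i and the points (t, t + w) involve no truncation. *)
Definition lpoint : Type := (int * int)%type.

Definition content (p : lpoint) : int := p.2 - p.1.

Definition segment (n : nat) : {fset int} := [fset i%:Z | i in iota 1 n].

Definition grid (a b : nat) : {fset int * int} := (segment a `*` segment b)%fset.

Definition BP (a b : nat) (alpha beta : {fset int}) : Prop :=
  [/\ (alpha `<=` segment a)%fset, (beta `<=` segment b)%fset
    & #|` alpha| = #|` beta|].

Definition increasing (A : {fset int}) : seq int := sort <=%R A.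

Definition path_step (p q : lpoint) : bool :=
  (q == (p.1, p.2 + 1)) || (q == (p.1 - 1, p.2)).

(* Paths from (a, y) to (x, b); the rectangle [a] x [b] need not be imposed,
   since steps only decrease the row and increase the column. *)
Definition Pi_paths (a b : nat) (x y : int) : set (seq (int * int)) :=
  [set Q | exists Q', [/\ Q = (a%:Z, y) :: Q', path path_step (a%:Z, y) Q'
                        & last (a%:Z, y) Q' = (x, b%:Z)]].

(* The first path must go on both before and after a common point. *)
Definition osculating (Q Q' : seq (int * int)) : Prop :=
  forall (m m' : nat) (i j : int),
    (m < size Q)%N -> (m' < size Q')%N ->
    nth (0, 0) Q m = (i, j) -> nth (0, 0) Q' m' = (i, j) ->
    [/\ (0 < m)%N /\ nth (0, 0) Q m.-1 = (i, j - 1),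
        (m.+1 < size Q)%N /\ nth (0, 0) Q m.+1 = (i - 1, j),
        m' = 0%N \/ nth (0, 0) Q' m'.-1 = (i + 1, j)
      & m'.+1 = size Q' \/ nth (0, 0) Q' m'.+1 = (i, j + 1)].

Definition OP (a b : nat) (alpha beta : {fset int}) :
    set (seq (seq (int * int))) :=
  [set P | [/\ size P = #|` alpha|,
      forall k, (k < size P)%N ->
        Pi_paths a b (nth 0 (increasing alpha) k) (nth 0 (increasing beta) k)
                 (nth [::] P k)
    & forall k, (k.+1 < size P)%N ->
        osculating (nth [::] P k) (nth [::] P k.+1)]].

Definition npaths_at (P : seq (seq (int * int))) (p : int * int) : nat :=
  count (fun Q => p \in Q) P.

Definition vacancy (P : seq (seq (int * int))) (p : int * int) : bool :=
  npaths_at P p == 0%N.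

Definition osculation (P : seq (seq (int * int))) (p : int * int) : bool :=
  (2 <= npaths_at P p)%N.

Definition Z (a b : nat) (P : seq (seq (int * int))) : {fset int * int} :=
  [fset p in grid a b | vacancy P p || osculation P p].

Definition OPl (a b : nat) (alpha beta : {fset int}) (l : nat) :
    set (seq (seq (int * int))) :=
  [set P | OP a b alpha beta P /\ #|` Z a b P| = l].

Definition VOS (a b : nat) (alpha beta : {fset int}) (l : nat) :
    set {fset int * int} :=
  [set Z a b P | P in OPl a b alpha beta l].

(* A partition is the decreasing sequence of its nonzero parts; trailing zeros
   are omitted so that Leibniz equality is equality of partitions. *)
Definition is_part (lambda : seq nat) : bool :=
  sorted geq lambda && (0%N \notin lambda).

Definition part (lambda : seq nat) (i : nat) : nat := nth 0%N lambda i.-1.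

Definition conjugate (lambda : seq nat) : seq nat :=
  [seq count (leq i) lambda | i <- iota 1 (part lambda 1)].

Definition young (lambda : seq nat) : set (nat * nat) :=
  [set p | (1 <= p.1 <= size lambda)%N /\ (1 <= p.2 <= part lambda p.1)%N].

Definition is_frobenius (gamma delta : seq int) (lambda : seq nat) : Prop :=
  [/\ is_part lambda,
      count (fun i => (i <= part lambda i)%N) (iota 1 (size lambda))
        = size gamma,
      size delta = size gamma
    & forall i, (1 <= i <= size gamma)%N ->
        (part lambda i)%:Z - i%:Z = nth 0 gamma i.-1 /\
        (part (conjugate lambda) i)%:Z - i%:Z = nth 0 delta i.-1].

(* Here and below, xget picks the unique object satisfying a specification; its
   first argument is a junk value for the case where there is none. *)
Definition frobenius (gamma delta : seq int) : seq nat :=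
  xget [::] (is_frobenius gamma delta).

Definition rect_compl (a b : nat) (lambda : seq nat) : seq nat :=
  [seq x <- [seq (b - part lambda i)%N | i <- rev (iota 1 a)] | x != 0%N].

Definition lambda_of (a b : nat) (alpha beta : {fset int}) : seq nat :=
  rect_compl a b (frobenius [seq b%:Z - y | y <- increasing beta]
                            [seq a%:Z - x | x <- increasing alpha]).

Definition adds_square (lambda mu : seq nat) (p : nat * nat) : Prop :=
  ~ young lambda p /\ young mu = young lambda `|` [set p].

Definition square_between (lambda mu : seq nat) : set (nat * nat) :=
  [set p | adds_square lambda mu p \/ adds_square mu lambda p].

Definition differ_by_square (lambda mu : seq nat) : Prop :=
  exists p, square_between lambda mu p.

Definition Delta (lambda mu : seq nat) : int :=
  let p := xget (0%N, 0%N) (square_between lambda mu) in p.2%:Z - p.1%:Z.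

Definition OT (lambda : seq nat) (l : nat) : set (seq (seq nat)) :=
  [set eta | [/\ size eta = l.+1, all is_part eta,
      nth [::] eta 0 = [::], nth [::] eta l = lambda
    & forall k, (k < l)%N ->
        differ_by_square (nth [::] eta k) (nth [::] eta k.+1)]].

Definition profile (eta : seq (seq nat)) : seq int :=
  mkseq (fun k => Delta (nth [::] eta k) (nth [::] eta k.+1)) (size eta).-1.

Definition GOT (T : {pred int}) (prec : rel int) (lambda : seq nat) (l : nat) :
    set (seq int * seq (seq nat)) :=
  [set te | [/\ size te.1 = l, {subset te.1 <= T}, OT lambda l te.2
    & forall k, (k.+1 < l)%N ->
        nth 0 te.1 k < nth 0 te.1 k.+1 \/
        nth 0 te.1 k = nth 0 te.1 k.+1 /\
        prec (nth 0 (profile te.2) k) (nth 0 (profile te.2) k.+1)]].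

Definition positive_point (p : lpoint) : bool := (1 <= p.1) && (1 <= p.2).

Definition pair_lt (L : lpoint -> int) (prec : rel int) (p q : lpoint) : bool :=
  (L p < L q) || (L p == L q) && prec (content p) (content q).

(* Values of op_L outside the positive quadrant are irrelevant. *)
Record ordering_pair := OrderingPair {
  op_L : lpoint -> int;
  op_prec : rel int;
  op_L_pos : forall p, positive_point p -> 1 <= op_L p;
  op_prec_irr : irreflexive op_prec;
  op_prec_trans : transitive op_prec;
  op_prec_total : forall x y, x != y -> op_prec x y || op_prec y x;
  op_compat : forall p q, positive_point p -> positive_point q ->
    pair_lt op_L op_prec p q -> p.1 < q.1 \/ p.2 < q.2
}.

Lemma lex_compat (p q : lpoint) : positive_point p -> positive_point q ->
  pair_lt fst <%R p q -> p.1 < q.1 \/ p.2 < q.2.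
Proof. by rewrite /pair_lt /content => _ _; lia. Qed.

Lemma antilex_compat (p q : lpoint) : positive_point p -> positive_point q ->
  pair_lt snd >%R p q -> p.1 < q.1 \/ p.2 < q.2.
Proof. by rewrite /pair_lt /content /= => _ _; lia. Qed.

Definition lex_pair : ordering_pair.
Proof.
by refine (@OrderingPair fst <%R _ _ _ _ lex_compat);
  [move=> p /andP[] | exact: ltxx | exact: lt_trans | move=> x y; lia].
Defined.

Definition antilex_pair : ordering_pair.
Proof.
by refine (@OrderingPair snd >%R _ _ _ _ antilex_compat);
  [move=> p /andP[] | exact: ltxx | move=> x y z /=; lia | move=> x y /=; lia].
Defined.

Definition progression (O : ordering_pair) (S : {fset int * int}) :
    seq (int * int) :=
  xget [::] [set s | perm_eq s S /\ sorted (pair_lt (op_L O) (op_prec O)) s].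

Definition tableau_of_profile (lambda : seq nat) (w : seq int) :
    seq (seq nat) :=
  xget [::] [set eta | OT lambda (size w) eta /\ profile eta = w].

Definition Theta (O : ordering_pair) (a b : nat) (alpha beta : {fset int})
    (S : {fset int * int}) : seq int * seq (seq nat) :=
  let s := progression O S in
  ([seq op_L O p | p <- s],
   tableau_of_profile (lambda_of a b alpha beta) [seq content p | p <- s]).

Definition Psi_lex (te : seq int * seq (seq nat)) : {fset int * int} :=
  [fset (x.1, x.1 + x.2) | x in zip te.1 (profile te.2)].

Definition Psi_antilex (te : seq int * seq (seq nat)) : {fset int * int} :=
  [fset (x.1 - x.2, x.1) | x in zip te.1 (profile te.2)].

Definition bij_with_inverse {T U : Type} (A : set T) (B : set U)
    (f : T -> U) (g : U -> T) : Prop :=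
  [/\ set_bij A B f, set_fun B A g,
      forall x, A x -> g (f x) = x & forall y, B y -> f (g y) = y].

(* Main.v *)
(* Give every half-diagonal of the lattice a bit: 1 on a horizontal edge exactly
   when a path uses it, 1 on a vertical edge exactly when no path uses it. At a
   point lying on one path the two bits pass through unchanged; at a vacancy or an
   osculation they are exchanged, and they must differ. On the left and upper sides
   of the rectangle the bits read 0 at negative and 1 at positive half-diagonals,
   which is the boundary profile (Maya diagram) of the empty partition; on the lower
   and right sides they read the profile of lambda_{a,b,alpha,beta}. Exchanging
   adjacent distinct bits adds or removes a square of the corresponding content, so
   reading Z(P) along any linear extension of the coordinatewise order gives an
   oscillating tableau, and conversely Z(P) determines all edges.
   It remains to see that in a generalized oscillating tableau each point
   (t, t + Omega) lies in the rectangle. Within one value of t the contents increase,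
   so at most one new row appears there, which gives t + Omega >= 1, and the first
   row loses at most one square there; as its final length is at most b - a, this
   gives t + Omega <= b. Negating contents and complementing bits turns the
   antilexicographic case into the lexicographic one. *)
Require Import Defs.
From mathcomp Require Import all_boot all_order all_algebra finmap.
From mathcomp Require Import all_classical.
From mathcomp Require Import zify.

Set Implicit Arguments.
Unset Strict Implicit.
Unset Printing Implicit Defensive.

Import Order.TTheory GRing.Theory Num.Theory.

(** * Bits on the edges of the lattice *)

Section Bits.
Local Open Scope ring_scope.

Lemma mem_segment n (x : int) : (x \in segment n) = (1 <= x <= n%:Z).
Proof.
apply/imfsetP/idP => /= [[i]|xn].
  by rewrite mem_iota => /andP[? ?] ->; lia.
by exists `|x|%N; [rewrite mem_iota; lia | lia].
Qed.

Lemma mem_grid a b (p : int * int) :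
  (p \in grid a b) = (1 <= p.1 <= a%:Z) && (1 <= p.2 <= b%:Z).
Proof. by rewrite in_fsetM !mem_segment. Qed.

(* The initial bit of the half-diagonal, flipped once for each point of [S] on the
   two neighbouring diagonals that precedes the edge leaving [p] to the right. *)
Definition right_bit (S : {fset int * int}) (p : lpoint) : bool :=
  (0 <= content p) (+) odd (count (fun q : lpoint =>
    [&& q.1 <= p.1, q.2 <= p.2 &
        (content q == content p) || (content q == content p + 1)]) S).

(** The counterpart of [right_bit] for the edge below [p], on the half-diagonal of content
    [content p - 1/2]; hence the strict [0 < content p] and the diagonals [content p - 1] and
    [content p]. *)
Definition bottom_bit (S : {fset int * int}) (p : lpoint) : bool :=
  (0 < content p) (+) odd (count (fun q : lpoint =>
    [&& q.1 <= p.1, q.2 <= p.2 &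
        (content q == content p) || (content q + 1 == content p)]) S).

Lemma count_with_point (S : {fset int * int}) (p : int * int)
    (f g : pred (int * int)) :
  ~~ g p -> f =1 predU (pred1 p) g -> count f S = ((p \in S) + count g S)%N.
Proof.
move=> gp fE; rewrite (eq_count fE) -(count_uniq_mem p (fset_uniq S)).
rewrite -count_predUI [X in (_ + X)%N](_ : _ = 0%N) ?addn0//.
rewrite (@eq_count _ _ pred0) ?count_pred0// => q /=.
by apply/negbTE/negP => /andP[/eqP->]; apply/negP.
Qed.

(** The edges to the left of and below [p] lie on one half-diagonal with only [p] between them, so
    the two counts differ exactly by [p]. *)
Lemma bottom_bitE S p :
  bottom_bit S p = right_bit S (p.1, p.2 - 1) (+) (p \in S).
Proof.
rewrite /bottom_bit /right_bit.
have -> : (0 < content p) = (0 <= content (p.1, p.2 - 1)).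
  by rewrite /content /=; lia.
rewrite -addbA; congr (_ (+) _); rewrite addbC -[in RHS](oddb (p \in S)) -oddD.
congr odd; apply: count_with_point => [|[i j]]; rewrite /content /=; first by lia.
by case: p => i0 j0 /=; rewrite xpair_eqE; lia.
Qed.

Lemma right_bitE S p :
  right_bit S p = bottom_bit S (p.1 - 1, p.2) (+) (p \in S).
Proof.
rewrite /bottom_bit /right_bit.
have -> : (0 <= content p) = (0 < content (p.1 - 1, p.2)).
  by rewrite /content /=; lia.
rewrite -addbA; congr (_ (+) _); rewrite addbC -[in RHS](oddb (p \in S)) -oddD.
congr odd; apply: count_with_point => [|[i j]]; rewrite /content /=; first by lia.
by case: p => i0 j0 /=; rewrite xpair_eqE; lia.
Qed.

(* Entry [c] is the bit of the half-diagonal of content [c - 1/2]. *)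
Definition state (w : seq int) (c : int) : bool :=
  (1 <= c) (+) odd (count (fun x => (x == c) || (x + 1 == c)) w).

(** [state] flips both bits next to a content; this is an exchange only if they differ, which is
    demanded of every step. *)
Definition valid (w : seq int) : Prop :=
  forall k, (k < size w)%N ->
    state (take k w) (nth 0 w k) != state (take k w) (nth 0 w k + 1).

(** The bits along the lower side from the left and then up the right side: column [j] has index
    [j - a], row [i] has index [b + 1 - i]. Beyond both ends the initial bits remain. *)
Definition target a b (alpha beta : {fset int}) (c : int) : bool :=
  if c <= - a%:Z then false
  else if c <= b%:Z - a%:Z then c + a%:Z \notin beta
  else if c <= b%:Z then b%:Z + 1 - c \in alpha
  else true.

Lemma state_nil c : state [::] c = (1 <= c).
Proof. by rewrite /state addbF. Qed.

Lemma state_rcons w x c :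
  state (rcons w x) c = state w c (+) ((x == c) || (x + 1 == c)).
Proof.
by rewrite /state -cats1 count_cat /= addn0 oddD oddb addbA.
Qed.

Lemma valid_rcons w x :
  valid (rcons w x) <-> valid w /\ state w x != state w (x + 1).
Proof.
split=> [v|[v vx] k].
  split=> [k kw|].
    have := v k; rewrite size_rcons ltnS (ltnW kw) => /(_ isT).
    by rewrite nth_rcons kw -cats1 takel_cat // ltnW.
  have := v (size w); rewrite size_rcons ltnSn => /(_ isT).
  by rewrite nth_rcons ltnn eqxx -cats1 take_size_cat.
rewrite size_rcons ltnS leq_eqVlt => /orP[/eqP->|kw].
  by rewrite nth_rcons ltnn eqxx -cats1 take_size_cat.
by rewrite nth_rcons kw -cats1 takel_cat ?(ltnW kw)//; apply: v.
Qed.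

(* The shape of [Z P]: the six-vertex rule at its points, and the boundary bits. *)
Definition vertex_set a b (alpha beta : {fset int}) (S : {fset int * int}) : Prop :=
  [/\ {subset S <= grid a b},
      forall p, p \in S -> right_bit S (p.1, p.2 - 1) != bottom_bit S (p.1 - 1, p.2)
    & forall c, state [seq content q | q <- S] c = target a b alpha beta c].

(** * Bits on the four sides of the rectangle *)

Section Boundary.
Variables (a b : nat) (S : {fset int * int}).
Hypothesis Sgrid : {subset S <= grid a b}.

Lemma S_box (q : int * int) : q \in S ->
  [/\ 1 <= q.1, q.1 <= a%:Z, 1 <= q.2 & q.2 <= b%:Z].
Proof. by move/Sgrid; rewrite mem_grid => /andP[/andP[? ?] /andP[? ?]]. Qed.

Lemma right_bit_left i : 1 <= i -> right_bit S (i, 0) = false.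
Proof.
move=> i1; rewrite /right_bit (@eq_in_count _ _ pred0).
  by rewrite count_pred0 /content /=; lia.
by move=> q /S_box[? ? ? ?]; rewrite /content /=; lia.
Qed.

Lemma bottom_bit_top j : 1 <= j -> bottom_bit S (0, j) = true.
Proof.
move=> i1; rewrite /bottom_bit (@eq_in_count _ _ pred0).
  by rewrite count_pred0 /content /=; lia.
by move=> q /S_box[? ? ? ?]; rewrite /content /=; lia.
Qed.

(** [S] lies in the rectangle, so every point of [S] on the two diagonals precedes an edge that
    leaves the rectangle. *)
Lemma right_bit_right i : 1 <= i <= a%:Z ->
  right_bit S (i, b%:Z) = state [seq content q | q <- S] (b%:Z - i + 1).
Proof.
move=> i1; rewrite /right_bit /state count_map; congr (_ (+) odd _).
  by rewrite /content /=; lia.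
by apply: eq_in_count => q /S_box[? ? ? ?]; rewrite /content /=; lia.
Qed.

Lemma bottom_bit_bottom j : 1 <= j <= b%:Z ->
  bottom_bit S (a%:Z, j) = state [seq content q | q <- S] (j - a%:Z).
Proof.
move=> i1; rewrite /bottom_bit /state count_map; congr (_ (+) odd _).
by apply: eq_in_count => q /S_box[? ? ? ?]; rewrite /content /=; lia.
Qed.

Lemma state_small c : c <= - a%:Z -> state [seq content q | q <- S] c = (1 <= c).
Proof.
move=> i1; rewrite /state count_map (@eq_in_count _ _ pred0).
  by rewrite count_pred0 addbF.
by move=> q /S_box[? ? ? ?]; rewrite /content /=; lia.
Qed.

Lemma state_large c : b%:Z < c -> state [seq content q | q <- S] c = (1 <= c).
Proof.
move=> i1; rewrite /state count_map (@eq_in_count _ _ pred0).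
  by rewrite count_pred0 addbF.
by move=> q /S_box[? ? ? ?]; rewrite /content /=; lia.
Qed.

End Boundary.

(** The lower and right sides meet the indices from [1 - a] to [b]; at all others no point of [S]
    acts, and [target] is the initial bit. *)
Lemma vertex_setP a b (alpha beta : {fset int}) (S : {fset int * int}) :
  {subset S <= grid a b} ->
  (forall c, state [seq content q | q <- S] c = target a b alpha beta c) <->
  (forall j, 1 <= j <= b%:Z -> bottom_bit S (a%:Z, j) = (j \notin beta)) /\
  (forall i, 1 <= i <= a%:Z -> right_bit S (i, b%:Z) = (i \in alpha)).
Proof.
move=> Sg; split=> [H|[Hb Hr] c].
  split=> [j jb|i ia].
    rewrite (bottom_bit_bottom Sg) // H /target ifF ?ifT; try lia.
    by rewrite subrK.
  rewrite (right_bit_right Sg) // H /target.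
  rewrite 2?ifF ?ifT; try lia.
  by have -> : b%:Z + 1 - (b%:Z - i + 1) = i by lia.
rewrite /target; case: ifP => c1; first by rewrite (state_small Sg)//; lia.
case: ifP => c2.
  rewrite -(_ : (c + a%:Z) - a%:Z = c); last lia.
  by rewrite -(bottom_bit_bottom Sg) ?Hb ?subrK//; lia.
case: ifP => c3; last by rewrite (state_large Sg); lia.
rewrite -Hr -?(right_bit_right Sg); try lia.
rewrite (right_bit_right Sg); last lia.
by congr (state _ _); lia.
Qed.
End Bits.

(** * Partitions and oscillating tableaux as bit sequences *)

Section Partitions.
Local Open Scope ring_scope.
Implicit Types lam mu : seq nat.

(* The zeros of the bit sequence of [lam] sit at [lam_i - i + 1], [i >= 1]. *)
Definition maya lam (c : int) : bool :=
  ~~ `[< exists r : nat, (nth 0%N lam r)%:Z - r%:Z = c >].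

Lemma mayaPn lam c :
  reflect (exists r : nat, (nth 0%N lam r)%:Z - r%:Z = c) (~~ maya lam c).
Proof. by rewrite negbK; exact: asboolP. Qed.

Lemma eq_maya lam mu c d :
  ((exists r : nat, (nth 0%N lam r)%:Z - r%:Z = c) <->
   (exists r : nat, (nth 0%N mu r)%:Z - r%:Z = d)) -> maya lam c = maya mu d.
Proof.
by move=> [H1 H2]; apply: negb_inj; apply/mayaPn/mayaPn.
Qed.

Lemma leq_antitone (f : nat -> nat) i j :
  (forall k, (f k.+1 <= f k)%N) -> (i <= j)%N -> (f j <= f i)%N.
Proof.
move=> fdec /subnK <-; elim: (j - i)%N => // n IH.
exact: leq_trans (fdec _) IH.
Qed.

Lemma part_leq lam r s : is_part lam -> (r <= s)%N -> (nth 0 lam s <= nth 0 lam r)%N.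
Proof.
move=> /andP[/(sortedP 0%N) lsort _].
apply: (@leq_antitone (nth 0%N lam)) => i.
have [/lsort//|ilam] := ltnP i.+1 (size lam).
by rewrite nth_default.
Qed.

Lemma part_gt0 lam r : is_part lam -> (0 < nth 0 lam r)%N = (r < size lam)%N.
Proof.
move=> /andP[_ l0]; have [rl|rl] := ltnP r (size lam); last by rewrite nth_default.
by rewrite lt0n; apply: contra l0 => /eqP <-; rewrite mem_nth.
Qed.

Lemma part_inj lam mu : is_part lam -> is_part mu ->
  (forall r, nth 0%N lam r = nth 0%N mu r) -> lam = mu.
Proof.
move=> lp mp E; apply: (@eq_from_nth _ 0%N) => [|r _]; last exact: E.
have le (x y : seq nat) : is_part x -> is_part y ->
    (forall r, nth 0%N x r = nth 0%N y r) -> (size x <= size y)%N.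
  move=> xp yp xy; case: (posnP (size x)) => [->//|sx].
  by rewrite -(prednK sx) -(part_gt0 _ yp) -xy (part_gt0 _ xp) prednK.
by apply/eqP; rewrite eqn_leq !le.
Qed.

(** For weakly decreasing [f] with [f n = 0], dropping the zeros only cuts the tail, so the rows are
    the values of [f]. *)
Definition shape_of (f : nat -> nat) (n : nat) : seq nat :=
  [seq x <- mkseq f n | x != 0%N].

Lemma nth_shape_of f n r : (forall i, (f i.+1 <= f i)%N) -> f n = 0%N ->
  nth 0%N (shape_of f n) r = f r.
Proof.
elim: n f r => [|n IH] f r fdec fn.
  by rewrite nth_nil; have := leq_antitone fdec (leq0n r); rewrite fn leqn0 => /eqP.
have fE : mkseq f n.+1 = f 0%N :: mkseq (f \o succn) n.
  by rewrite /mkseq /= -[1%N]addn0 iotaDl -map_comp.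
rewrite /shape_of fE /=; have [f0|f0] := eqVneq (f 0%N) 0%N.
  have fr i : f i = 0%N by apply/eqP; rewrite -leqn0 -f0; apply: leq_antitone.
  by have /= := IH (f \o succn) r; rewrite /shape_of => -> //=; rewrite fr.
case: r => [|r] //=.
by have /= := IH (f \o succn) r; rewrite /shape_of => -> //=.
Qed.

Lemma shape_of_part f n : (forall i, (f i.+1 <= f i)%N) -> is_part (shape_of f n).
Proof.
move=> fdec; rewrite /is_part mem_filter /= andbT.
apply: sorted_filter => [y x z /= xy yz|]; first exact: leq_trans yz xy.
apply/(sortedP 0%N) => i; rewrite size_mkseq => ni.
by rewrite !nth_mkseq ?(ltnW ni)//=.
Qed.

Lemma youngE lam r m : is_part lam -> young lam (r.+1, m.+1) <-> (m < nth 0 lam r)%N.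
Proof.
move=> lp; rewrite /young /part /=; split=> [[_]//|mr]; split=> //.
by rewrite -(part_gt0 _ lp) (leq_trans _ mr).
Qed.

(** Each row of a Young diagram is an initial interval of cells, so a new cell can only come right
    after the last cell of its row. *)
Lemma adds_squareP lam mu p : is_part lam -> is_part mu ->
  adds_square lam mu p <->
  exists r, p = (r.+1, (nth 0 lam r).+1)%N /\
    forall s, nth 0%N mu s = (nth 0%N lam s + (s == r))%N.
Proof.
move=> lp mp; split.
  case: p => [i j] [nlam yE].
  have : young mu (i, j) by rewrite yE; right.
  case: i j nlam yE => [|r] [|m] nlam yE; try by case.
  move=> /(youngE _ _ mp) mr.
  have {}nlam : (nth 0 lam r <= m)%N.
    by rewrite leqNgt; apply/negP => /(youngE _ _ lp).
  have E s n : (n < nth 0 mu s)%N = (n < nth 0 lam s)%N || ((s == r) && (n == m)).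
    apply/idP/idP => [/(youngE _ _ mp)|].
      by rewrite yE => -[/(youngE _ _ lp)->//|[-> ->]]; rewrite !eqxx orbT.
    move=> /orP[/(youngE _ _ lp)|/andP[/eqP-> /eqP->]//] ys.
    by apply/(youngE _ _ mp); rewrite yE; left.
  have mE : m = nth 0%N lam r by have := E r (nth 0%N lam r); lia.
  exists r; split=> [|s]; first by rewrite -mE.
  have [->|sr] := eqVneq s r.
    by have := E r (m.+1); lia.
  have := E s (nth 0%N lam s); have := E s (nth 0%N mu s).
  by rewrite (negbTE sr); lia.
move=> [r [-> muE]]; split; first by move=> /(youngE _ _ lp); rewrite ltnn.
apply/seteqP; split=> -[[|i] [|j]]; try by [case|case; case].
- move=> /(youngE _ _ mp); rewrite muE => ji.
  have [ji'|ji'] := ltnP j (nth 0%N lam i); first by left; apply/(youngE _ _ lp).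
  right=> /=; have [ir|ir] := eqVneq i r; last by move: ji; rewrite (negbTE ir); lia.
  by move: ji ji'; rewrite ir eqxx => ? ?; congr (_, _); lia.
- move=> [/(youngE _ _ lp) ji|[-> ->]]; apply/(youngE _ _ mp); rewrite muE; first by lia.
  by rewrite eqxx addn1.
Qed.

Lemma beta_lt lam r s : is_part lam -> (r < s)%N ->
  (nth 0%N lam s)%:Z - s%:Z < (nth 0%N lam r)%:Z - r%:Z.
Proof. by move=> lp rs; have := part_leq lp (ltnW rs); lia. Qed.

Lemma beta_inj lam r s : is_part lam ->
  (nth 0%N lam s)%:Z - s%:Z = (nth 0%N lam r)%:Z - r%:Z -> s = r.
Proof.
by move=> lp E; case: (ltngtP r s) => // /(beta_lt lp); rewrite E ltxx.
Qed.

(** Adding a square to row [r] moves the zero of that row from [c] to [c + 1] and leaves the other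
    zeros in place. *)
Lemma adds_square_maya lam mu p : is_part lam -> is_part mu -> adds_square lam mu p ->
  let c := p.2%:Z - p.1%:Z in
  [/\ maya lam c = false, maya lam (c + 1) = true
    & forall d, maya mu d = maya lam d (+) ((c == d) || (c + 1 == d))].
Proof.
move=> lp mp /(adds_squareP _ lp mp)[r [-> muE]] /=.
have -> : (nth 0%N lam r).+1%:Z - r.+1%:Z = (nth 0%N lam r)%:Z - r%:Z by lia.
set c := _ - _.
have lc : maya lam c = false by apply/negbTE/mayaPn; exists r.
have muo s : s != r -> nth 0%N mu s = nth 0%N lam s by rewrite muE => /negbTE->; lia.
have mur : nth 0%N mu r = (nth 0%N lam r).+1 by rewrite muE eqxx addn1.
(* A zero of [lam] at [c + 1] would belong to a row [s] other than [r], and then rows [s] and [r] of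
   [mu] would give the same zero. *)
have lc1 : maya lam (c + 1) = true.
  apply: contraT => /mayaPn[s]; have [->|sr] := eqVneq s r; first by rewrite /c; lia.
  rewrite -(muo _ sr) => E; case/eqP: sr; apply: (beta_inj mp).
  by rewrite E mur /c; lia.
split=> // d; have [<-|cd] := eqVneq c d.
  rewrite lc /=; apply: contraT => /mayaPn[s].
  have [->|sr] := eqVneq s r; first by rewrite mur /c; lia.
  by rewrite muo // => /(beta_inj lp) /eqP; rewrite (negbTE sr).
have [<-|cd1] := eqVneq (c + 1) d.
  by rewrite lc1 /=; apply/negbTE/mayaPn; exists r; rewrite mur /c; lia.
rewrite addbF; apply: eq_maya; split=> -[s Es]; exists s; move: Es.
  have [->|sr] := eqVneq s r; last by rewrite muo.
  by rewrite mur => E; case/eqP: cd1; rewrite /c; lia.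
have [->|sr] := eqVneq s r; last by rewrite muo.
by move=> E; case/eqP: cd.
Qed.

Lemma square_between_maya lam mu p : is_part lam -> is_part mu ->
  square_between lam mu p ->
  let c := p.2%:Z - p.1%:Z in
  maya lam c != maya lam (c + 1) /\
  forall d, maya mu d = maya lam d (+) ((c == d) || (c + 1 == d)).
Proof.
move=> lp mp [/(adds_square_maya lp mp)|/(adds_square_maya mp lp)] [].
  by move=> m0 m1 H c; rewrite /c m0 m1.
move=> mc mc1 H c; rewrite {}/c; split=> [|d]; last by rewrite H addbK.
by rewrite !H mc mc1 !eqxx orbT.
Qed.

Lemma Delta_maya lam mu : is_part lam -> is_part mu -> differ_by_square lam mu ->
  let c := Delta lam mu in
  maya lam c != maya lam (c + 1) /\
  forall d, maya mu d = maya lam d (+) ((c == d) || (c + 1 == d)).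
Proof.
by move=> lp mp dif; apply: (square_between_maya lp mp); apply: (xgetPex (0%N, 0%N)).
Qed.

(** [Delta] uses a chosen square; any other gives the same content, because the flipped positions
    are exactly [c] and [c + 1]. *)
Lemma DeltaE lam mu p : is_part lam -> is_part mu -> square_between lam mu p ->
  Delta lam mu = p.2%:Z - p.1%:Z.
Proof.
move=> lp mp pb; have [_ H1] := square_between_maya lp mp pb.
have dif : differ_by_square lam mu by exists p.
have [_ H2] := Delta_maya lp mp dif.
move: H1 H2; set c := (_ - _ : int); set c' := Delta _ _ => H1 H2.
have E d : ((c == d) || (c + 1 == d)) = ((c' == d) || (c' + 1 == d)).
  by apply: (@addbI (maya lam d)); rewrite -H1 H2.
by have := E c; have := E (c + 1); have := E c'; lia.
Qed.

Lemma maya_nil c : maya [::] c = (1 <= c).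
Proof.
apply: negb_inj; apply/mayaPn/idP => [[r]|c0]; first by rewrite nth_nil; lia.
by exists `|c|%N; rewrite nth_nil; lia.
Qed.

(** The values [lam_r - r] strictly decrease, so the zeros, listed downwards, give back the rows one
    after another. *)
Lemma maya_inj lam mu : is_part lam -> is_part mu -> maya lam =1 maya mu -> lam = mu.
Proof.
move=> lp mp E; apply: part_inj => // r.
have le x y k : is_part x -> is_part y -> maya x =1 maya y ->
    (forall s, (s < k)%N -> nth 0%N x s = nth 0%N y s) -> (nth 0 x k <= nth 0 y k)%N.
  move=> xp yp xy IH.
  have /mayaPn[s Es] : ~~ maya y ((nth 0%N x k)%:Z - k%:Z).
    by rewrite -xy; apply/mayaPn; exists k.
  have ks : (k <= s)%N.
    rewrite leqNgt; apply/negP => sk; move: Es; rewrite -IH // => /(beta_inj xp); lia.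
  by have := part_leq yp ks; lia.
elim/ltn_ind: r => r IH; apply/eqP; rewrite eqn_leq !le // => s /IH //.
Qed.

(** Bits [1, 0] at [c, c + 1] allow the removal of a square, bits [0, 1] the addition of one. In
    both cases the bit 1 says that the adjacent row has a different length, which keeps the rows
    weakly decreasing. *)
Lemma maya_swap lam c : is_part lam -> maya lam c != maya lam (c + 1) ->
  exists mu p, [/\ is_part mu, square_between lam mu p & p.2%:Z - p.1%:Z = c].
Proof.
move=> lp; case lc: (maya lam c); case lc1: (maya lam (c + 1)) => // _.
- move/negbT/mayaPn: lc1 => [r Er].
  have dec : (nth 0 lam r.+1 < nth 0 lam r)%N.
    have := part_leq lp (leqnSn r); rewrite leq_eqVlt => /orP[/eqP E|//].
    suff : ~~ maya lam c by rewrite lc.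
    by apply/mayaPn; exists r.+1; rewrite E; lia.
  pose f s := (nth 0%N lam s - (s == r))%N.
  have fdec i : (f i.+1 <= f i)%N.
    rewrite /f; have := part_leq lp (leqnSn i).
    by have [->|ir] := eqVneq i r; [move: dec; lia | lia].
  have fl : f (size lam) = 0%N by rewrite /f nth_default.
  have mp := shape_of_part (size lam) fdec.
  exists (shape_of f (size lam)), (r.+1, nth 0%N lam r); split=> //; last by move=> /=; lia.
  right; apply/adds_squareP => //; exists r; rewrite nth_shape_of // /f eqxx.
  split=> [|s]; first by congr (_, _); lia.
  by rewrite nth_shape_of // /f; have [->|sr] := eqVneq s r; lia.
- move/negbT/mayaPn: lc => [r Er].
  pose f s := (nth 0%N lam s + (s == r))%N.
  have fdec i : (f i.+1 <= f i)%N.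
    rewrite /f; have := part_leq lp (leqnSn i); rewrite leq_eqVlt => /orP[/eqP E|]; last lia.
    have [ir|ir] := eqVneq i.+1 r; last lia.
    suff : ~~ maya lam (c + 1) by rewrite lc1.
    by apply/mayaPn; exists i; rewrite -E; move: Er; rewrite -ir; lia.
  (* The row that grows may be the first empty one, [r = size lam], so the range has to reach past
     it. *)
  pose n := maxn (size lam) r.+1.
  have fl : f n = 0%N by rewrite /f nth_default ?leq_maxl//; rewrite /n; lia.
  have mp := shape_of_part n fdec.
  exists (shape_of f n), (r.+1, (nth 0%N lam r).+1); split=> //; last by move=> /=; lia.
  left; apply/adds_squareP => //; exists r; split=> // s.
  by rewrite nth_shape_of.
Qed.

End Partitions.

(** * Oscillating tableaux and their profiles *)

Section Tableaux.
Local Open Scope ring_scope.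

Lemma OT_state lam l eta : OT lam l eta ->
  [/\ size (profile eta) = l, valid (profile eta)
    & forall k, (k <= l)%N -> maya (nth [::] eta k) =1 state (take k (profile eta))].
Proof.
move=> [sz /allP parts e0 el steps].
have szp : size (profile eta) = l by rewrite size_mkseq sz.
have pt k : (k <= l)%N -> is_part (nth [::] eta k).
  by move=> kl; apply: parts; rewrite mem_nth // sz ltnS.
have stp k (kl : (k < l)%N) := Delta_maya (pt k (ltnW kl)) (pt k.+1 kl) (steps k kl).
have nthp k : (k < l)%N -> nth 0 (profile eta) k = Delta (nth [::] eta k) (nth [::] eta k.+1).
  by move=> kl; rewrite nth_mkseq // sz.
have H k : (k <= l)%N -> maya (nth [::] eta k) =1 state (take k (profile eta)).
  elim: k => [|k IH] kl c; first by rewrite e0 take0 maya_nil state_nil.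
  rewrite (take_nth 0) ?szp // state_rcons nthp //.
  by have [_ ->] := stp _ kl; rewrite IH // ltnW.
split=> // k; rewrite szp => kl; rewrite -!H ?nthp //; try exact: ltnW.
by have [] := stp _ kl.
Qed.

(** Built backwards from [lam]: [maya_swap] undoes the last exchange, and at the empty profile the
    bits force the empty partition. *)
Lemma OT_exists lam w : valid w -> is_part lam -> maya lam =1 state w ->
  exists2 eta, OT lam (size w) eta & profile eta = w.
Proof.
elim/last_ind: w lam => [|w x IH] lam.
  move=> _ lp E; exists [:: [::]] => //; split=> //=.
  by apply: maya_inj => // c; rewrite E maya_nil state_nil.
move=> /valid_rcons[vw wx] lp E.
(* After the exchange the two bits are swapped, hence still different. *)
have /maya_swap : maya lam x != maya lam (x + 1).
  rewrite !E !state_rcons !eqxx /= orbT; case: eqP => [|_]; first lia.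
  by move: wx; do 2 case: (state w _).
move=> /(_ lp)[mu [p [mp lmu px]]].
have [eta ot pe] : exists2 eta, OT mu (size w) eta & profile eta = w.
  apply: IH => // c; have [_ ->] := square_between_maya lp mp lmu.
  by rewrite E state_rcons px addbK.
have {}lmu : square_between mu lam p by case: lmu; [right | left].
have [sz pts e0 el steps] := ot; exists (rcons eta lam).
  rewrite size_rcons; split; rewrite ?size_rcons ?sz ?all_rcons ?lp //.
  - by rewrite nth_rcons sz.
  - by rewrite nth_rcons sz ltnn eqxx.
  move=> k; rewrite ltnS leq_eqVlt => /orP[/eqP->|kw]; rewrite !nth_rcons sz.
    by rewrite ltnSn ltnn eqxx el; exists p.
  by rewrite ltnS (ltnW kw) ltnS kw; apply: steps.
rewrite -pe; apply: (@eq_from_nth _ 0); first by rewrite size_rcons !size_mkseq size_rcons sz.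
move=> k; rewrite size_mkseq size_rcons sz /= ltnS => kw.
rewrite nth_mkseq ?size_rcons ?sz // !nth_rcons size_mkseq !sz /= ltnS kw.
move: kw; rewrite leq_eqVlt => /orP[/eqP->|kw].
  by rewrite !ltnn !eqxx el (DeltaE mp lp lmu).
by rewrite kw ltnS kw nth_mkseq // sz.
Qed.

Lemma OT_unique lam l eta eta' : OT lam l eta -> OT lam l eta' ->
  profile eta = profile eta' -> eta = eta'.
Proof.
move=> ot ot' pe.
have [_ _ st] := OT_state ot; have [_ _ st'] := OT_state ot'.
have [sz /allP pts _ _ _] := ot; have [sz' /allP pts' _ _ _] := ot'.
apply: (@eq_from_nth _ [::]) => [|k]; first by rewrite sz sz'.
rewrite sz => kl; apply: maya_inj.
- by apply: pts; rewrite mem_nth ?sz.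
- by apply: pts'; rewrite mem_nth ?sz'.
- by move=> c; rewrite st // st' // pe.
Qed.

Lemma tableau_of_profileP lam w : valid w -> is_part lam -> maya lam =1 state w ->
  OT lam (size w) (tableau_of_profile lam w) /\
  profile (tableau_of_profile lam w) = w.
Proof.
move=> vw lp E; have [eta ot pe] := OT_exists vw lp E.
by apply: (@xgetPex _ [::] [set eta | OT lam (size w) eta /\ profile eta = w]%classic); exists eta.
Qed.

Lemma tableau_of_profileK lam l eta : OT lam l eta ->
  tableau_of_profile lam (profile eta) = eta.
Proof.
move=> ot; have [sz _ _] := OT_state ot.
have : [set x | OT lam (size (profile eta)) x /\ profile x = profile eta]%classic
  (tableau_of_profile lam (profile eta)).
  by apply: xgetPex; exists eta; rewrite /= sz.
by case=> ot' pe; rewrite sz in ot'; apply: (OT_unique ot' ot pe).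
Qed.

End Tableaux.

(** * Frobenius notation *)

Section Frobenius.
Local Open Scope ring_scope.

(** The rows of [F] of length at least [j] are its first ones, so their number is the length of
    column [j]. *)
Lemma lt_count_leq (F : seq nat) j s : is_part F ->
  (0 < j)%N -> (s < count (leq j) F)%N = (j <= nth 0 F s)%N.
Proof.
move=> /andP[+ _] j0; elim: F s => [|x F IH] s /= Fs; first by rewrite nth_nil; lia.
have /allP Fx := order_path_min (fun y x z (xy : geq x y) yz => leq_trans yz xy) Fs.
have [jx|xj] := leqP j x; first by case: s => [|s] //=; rewrite ltnS IH // (path_sorted Fs).
have -> : count (leq j) F = 0%N.
  apply/eqP; rewrite -leqn0 leqNgt -has_count; apply/hasPn => y /Fx /=; lia.
case: s => [|s] /=; first by lia.
have [sF|sF] := ltnP s (size F); last by rewrite nth_default //; lia.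
by have /= := Fx _ (mem_nth 0%N sF); lia.
Qed.

(** [P] holds on an initial interval of the positive integers, and the count is the length of its
    part in [[1, n]]. *)
Lemma le_count_iota (P : pred nat) n i : (forall k, (0 < k)%N -> P k.+1 -> P k) ->
  (0 < i <= n)%N -> P i = (i <= count P (iota 1 n))%N.
Proof.
move=> Pdec; elim: n => [|n IH]; first by lia.
rewrite -(addn1 n) iotaD count_cat /= add1n addn0.
case Pn: (P n.+1) => /=; last first.
  rewrite addn0 => i0; have [in1|in1] := leqP i n; first by rewrite IH //; lia.
  have -> : i = n.+1 by lia.
  by rewrite Pn; have := count_size P (iota 1 n); rewrite size_iota; lia.
have allP k : (0 < n.+1 - k)%N -> P (n.+1 - k)%N.
  elim: k => [|k IHk] k0; first by rewrite subn0.
  by apply: Pdec => //; rewrite -subSn ?subSS; [apply: IHk|]; lia.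
have Pk k : (0 < k <= n.+1)%N -> P k.
  by move=> kn; have := allP (n.+1 - k)%N; rewrite subKn; [apply|]; lia.
move=> i0; rewrite Pk; last by lia.
rewrite (@eq_in_count _ _ predT) ?count_predT ?size_iota; first by lia.
by move=> k; rewrite mem_iota => kn; rewrite Pk //; lia.
Qed.

Definition strictly_decreasing (s : seq int) : Prop :=
  forall i j, (i < j < size s)%N -> nth 0 s j < nth 0 s i.

(** Strictly decreasing integers drop by at least one per index. *)
Lemma decreasing_slack s i j : strictly_decreasing s -> (i <= j < size s)%N ->
  nth 0 s j + j%:Z <= nth 0 s i + i%:Z.
Proof.
move=> sdec; elim: j => [|j IH] ij; first by have -> : i = 0%N by lia.
move: (ij) => /andP[]; rewrite leq_eqVlt => /orP[/eqP->//|ij' js].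
have /IH : (i <= j < size s)%N by lia.
by have := sdec j j.+1; lia.
Qed.

Lemma part_conjugate F j : is_part F -> (0 < j <= part F 1)%N ->
  part (conjugate F) j = count (leq j) F.
Proof.
move=> Fp j0; rewrite {1}/part /conjugate (nth_map 0%N) ?nth_iota ?size_iota; try lia.
by congr (count (leq _) _); lia.
Qed.

(** * Existence of a partition with given Frobenius data *)

Section Existence.
Variables gamma delta : seq int.
Hypotheses (szE : size delta = size gamma)
  (gdec : strictly_decreasing gamma) (ddec : strictly_decreasing delta)
  (g0 : forall k, (k < size gamma)%N -> 0 <= nth 0 gamma k)
  (d0 : forall k, (k < size gamma)%N -> 0 <= nth 0 delta k).

Let r := size gamma.

(* Rows below the Durfee square are read off the columns given by [delta]. *)
Definition frobenius_row (i : nat) : nat :=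
  if (i < size gamma)%N then (`|nth 0%R gamma i| + i.+1)%N
  else count (fun k => i%:Z <= nth 0 delta k + k%:Z) (iota 0 (size gamma)).

Lemma frobenius_row_dec i : (frobenius_row i.+1 <= frobenius_row i)%N.
Proof.
rewrite /frobenius_row; have [ir|ir] := ltnP i.+1 (size gamma).
  rewrite (ltnW ir); have := gdec (i := i) (j := i.+1); have := g0 ir; lia.
case: ltnP => [ir'|ir']; last by apply: sub_count => k /=; lia.
by apply: leq_trans (count_size _ _) _; rewrite size_iota; lia.
Qed.

(** An index past the last nonempty row: [delta_k + k] is at most [delta_0] by
    [decreasing_slack]. *)
Let n := (r + `|nth 0%R delta 0|).+1.

Lemma frobenius_row0 : frobenius_row n = 0%N.
Proof.
rewrite /frobenius_row ifF; last by rewrite /n /r; lia.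
apply/eqP; rewrite -leqn0 leqNgt -has_count; apply/hasPn => k; rewrite mem_iota => kr.
by have := decreasing_slack (i := 0%N) (j := k) ddec; rewrite szE /n /r; lia.
Qed.

(** Column [i] has [delta_(i-1) + i] cells. Below the Durfee square, [delta_k + k] decreases weakly,
    so the columns counted in a row are the first ones; inside the square both sides are true. *)
Lemma le_frobenius_row i s : (0 < i <= r)%N ->
  (i <= frobenius_row s)%N = (s%:Z < nth 0 delta i.-1 + i%:Z).
Proof.
move=> ir; have dk := decreasing_slack ddec; rewrite szE -/r in dk.
have di := d0 (k := r.-1); rewrite -/r in di.
rewrite /frobenius_row -/r; case: ltnP => sr.
  have := decreasing_slack gdec (i := s) (j := r.-1); have := g0 (k := r.-1); rewrite -/r.
  by have := dk i.-1 r.-1; lia.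
set P := (X in count X _).
have split_count m : (m <= r)%N ->
    count P (iota 0 r) = (count P (iota 0 m) + count P (iota m (r - m)))%N.
  by move=> mr; rewrite -count_cat -[in iota m _](add0n m) -iotaD subnKC.
have [si|si] := ltP s%:Z.
  rewrite (split_count i); last lia.
  rewrite (@eq_in_count _ _ predT (iota 0 i)) ?count_predT ?size_iota ?leq_addr//.
  by move=> /= k; rewrite mem_iota => ki; have {}dk := dk k i.-1 ltac:(lia); rewrite /P; lia.
rewrite (split_count i.-1); last lia.
rewrite [X in (_ + X)%N](@eq_in_count _ _ pred0) ?count_pred0; last first.
  move=> /= k; rewrite mem_iota => ki.
  by have {}dk := dk i.-1 k ltac:(lia); apply/negbTE; rewrite /P; lia.
have := count_size P (iota 0 i.-1).
by rewrite size_iota; lia.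
Qed.

Lemma frobenius_exists : exists F, is_frobenius gamma delta F.
Proof.
pose F := shape_of frobenius_row n.
have Fn k : nth 0%N F k = frobenius_row k.
  exact: nth_shape_of frobenius_row_dec frobenius_row0.
have Fp : is_part F := shape_of_part n frobenius_row_dec.
have diag k : (0 < k)%N -> (k <= part F k)%N = (k <= r)%N.
  move=> k0; rewrite /part Fn /frobenius_row -/r.
  case: ltnP => kr; first by lia.
  by set P := (X in count X _); have := count_size P (iota 0 r); rewrite size_iota; lia.
have rF : (r <= size F)%N.
  have [->//|r0] := posnP r; rewrite -(prednK r0) -(part_gt0 _ Fp) Fn /frobenius_row -/r.
  by rewrite ltn_predL r0; lia.
exists F; split=> //.
  rewrite (@eq_in_count _ _ (fun k => k <= r)%N); last first.
    by move=> k; rewrite mem_iota => /andP[k0 _]; rewrite diag.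
  rewrite -(subnKC rF) iotaD count_cat (@eq_in_count _ _ predT) ?count_predT ?size_iota; last first.
    by move=> k; rewrite mem_iota /=; lia.
  rewrite (@eq_in_count _ _ pred0) ?count_pred0 ?addn0// => k.
  by rewrite mem_iota /=; lia.
move=> k /andP[k0 kr]; split.
  rewrite /part Fn /frobenius_row ifT; last lia.
  by have := g0 (k := k.-1); lia.
rewrite part_conjugate //; last first.
  rewrite k0 (leq_trans _ (part_leq (r := 0) (s := k.-1) Fp _)) //=.
  by rewrite -/(part F k) diag.
suff E s : (s < count (leq k) F)%N = (s%:Z < nth 0 delta k.-1 + k%:Z).
  have := E (count (leq k) F); have := E (count (leq k) F).-1.
  have := d0 (k := k.-1); have := E (`|nth 0%R delta k.-1| + k)%N; lia.
by rewrite lt_count_leq // Fn le_frobenius_row // k0.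
Qed.

End Existence.

(** Row lengths decrease weakly, so the rows that reach the diagonal form an initial segment, whose
    length [is_frobenius] prescribes. *)
Lemma part_durfee gamma delta F i : is_frobenius gamma delta F -> (0 < i)%N ->
  (i <= part F i)%N = (i <= size gamma)%N.
Proof.
move=> [Fp <- _ _] i0; have [iF|iF] := leqP i (size F).
  rewrite -(@le_count_iota (fun i => i <= part F i)%N) ?i0 // => k k0 /=.
  by have := part_leq Fp (r := k.-1) (s := k) ltac:(lia); rewrite /part /=; lia.
have -> : part F i = 0%N by rewrite /part nth_default //; lia.
by set P := (X in count X _); have := count_size P (iota 1 (size F)); rewrite size_iota; lia.
Qed.

Lemma frobenius_col gamma delta F j s : is_frobenius gamma delta F ->
  (j < size gamma)%N -> (j < nth 0 F s)%N = (s%:Z <= nth 0 delta j + j%:Z).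
Proof.
move=> Ff jr; have [Fp _ _ /(_ j.+1)[|_]] := Ff; first by lia.
rewrite part_conjugate //; last first.
  have := part_durfee Ff (ltn0Sn j); have := part_leq Fp (leq0n j).
  by rewrite /part /=; lia.
by rewrite -(lt_count_leq (j := j.+1) s Fp) //=; lia.
Qed.

(** * The bit sequence of the complement in the rectangle *)

Section Boundary.
Variables (a b : nat) (alpha beta : {fset int}).
Hypothesis bp : BP a b alpha beta.

Let al := increasing alpha.
Let be := increasing beta.
Let r := #|` alpha|.

Lemma increasing_sorted (A : {fset int}) : sorted <%R (increasing A).
Proof. by rewrite lt_sorted_uniq_le sort_uniq fset_uniq sort_le_sorted. Qed.

Lemma increasing_lt (A : {fset int}) i j : (i < j < #|` A|)%N ->
  nth 0 (increasing A) i < nth 0 (increasing A) j.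
Proof.
move=> /andP[ij jA]; move: (increasing_sorted A) => /(sorted_ltn_nth lt_trans 0).
apply; rewrite ?inE ?size_sort //; apply: ltn_trans ij jA.
Qed.

Lemma mem_increasing (A : {fset int}) x :
  reflect (exists2 i, (i < #|` A|)%N & nth 0 (increasing A) i = x) (x \in A).
Proof.
by rewrite -[x \in A](mem_sort <=%R) -(size_sort <=%R); apply: nthP.
Qed.

Let size_al : size al = r. Proof. by rewrite size_sort. Qed.
Let size_be : size be = r. Proof. by rewrite size_sort /r; case: bp => _ _ ->. Qed.

Lemma al_bound k : (k < r)%N -> 1 <= nth 0 al k <= a%:Z.
Proof.
move=> kr; rewrite -mem_segment; case: bp => /fsubsetP sub _ _; apply: sub.
by apply/mem_increasing; exists k.
Qed.

Lemma be_bound k : (k < r)%N -> 1 <= nth 0 be k <= b%:Z.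
Proof.
move=> kr; rewrite -mem_segment; case: bp => _ /fsubsetP sub E; apply: sub.
by apply/mem_increasing; exists k => //; rewrite -E.
Qed.

Let gamma := [seq b%:Z - y | y <- be].
Let delta := [seq a%:Z - x | x <- al].

Let nth_gamma k : (k < r)%N -> nth 0 gamma k = b%:Z - nth 0 be k.
Proof. by move=> kr; rewrite (nth_map 0) ?size_be. Qed.
Let nth_delta k : (k < r)%N -> nth 0 delta k = a%:Z - nth 0 al k.
Proof. by move=> kr; rewrite (nth_map 0) ?size_al. Qed.
Let size_gamma : size gamma = r. Proof. by rewrite size_map size_be. Qed.
Let size_delta : size delta = r. Proof. by rewrite size_map size_al. Qed.

Let F := frobenius gamma delta.

Let delta_dec : strictly_decreasing delta.
Proof.
move=> i j; rewrite size_delta => ij; rewrite !nth_delta; try lia.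
by have := increasing_lt ij; rewrite -/al; lia.
Qed.

Lemma frobenius_of_boundary : is_frobenius gamma delta F.
Proof.
apply: (@xgetPex _ [::] (is_frobenius gamma delta)).
apply: frobenius_exists => //; rewrite ?size_gamma ?size_delta //.
- move=> i j; rewrite size_gamma => ij; rewrite !nth_gamma; try lia.
  by have := @increasing_lt beta i j; case: bp => _ _ <-; rewrite -/be => /(_ ij); lia.
- by move=> k kr; rewrite nth_gamma //; have := be_bound kr; lia.
- by move=> k kr; rewrite nth_delta //; have := al_bound kr; lia.
Qed.

Let Fp : is_part F. Proof. by case: frobenius_of_boundary. Qed.

Let durfee i : (i < nth 0 F i)%N = (i < r)%N.
Proof. by have := part_durfee frobenius_of_boundary (ltn0Sn i); rewrite size_gamma. Qed.

Let F_col j s : (j < r)%N -> (j < nth 0 F s)%N = (s%:Z <= a%:Z - nth 0 al j + j%:Z).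
Proof.
by move=> jr; rewrite (frobenius_col s frobenius_of_boundary) ?size_gamma // nth_delta.
Qed.

Let F_row k : (k < r)%N -> (nth 0%N F k)%:Z = b%:Z - nth 0 be k + k%:Z + 1.
Proof.
move=> kr; have [_ _ _ /(_ k.+1)] := frobenius_of_boundary.
rewrite size_gamma /= nth_gamma // => /(_ kr)[]; rewrite /part /=; lia.
Qed.

Let r_le_a : (r <= a)%N.
Proof.
have [+ _ _] := bp => /fsubset_leq_card /leq_trans; apply.
by rewrite (leq_trans (leq_imfset_card _ _ _)) //= undup_id ?iota_uniq ?size_iota.
Qed.

Let F_le_b s : (nth 0 F s <= b)%N.
Proof.
have := part_leq Fp (leq0n s); have := durfee 0; have [r0|r0] := posnP r; first by lia.
by have := F_row r0; have := be_bound r0; lia.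
Qed.

Let row k := if (k < a)%N then (b - nth 0 F (a.-1 - k))%N else 0%N.

Let row_dec k : (row k.+1 <= row k)%N.
Proof.
rewrite /row; case: ltnP => // ka; rewrite (ltnW ka).
by apply: leq_sub2l; apply: part_leq => //; lia.
Qed.

Let lambda_ofE : lambda_of a b alpha beta = shape_of row a.
Proof.
rewrite /lambda_of /rect_compl /shape_of.
congr [seq x <- _ | x != 0%N]; apply: (@eq_from_nth _ 0%N);
  rewrite size_map size_rev size_iota ?size_mkseq //.
move=> i ia; rewrite (nth_map 0%N) ?size_rev ?size_iota // nth_mkseq // /row ia.
rewrite nth_rev ?size_iota // nth_iota; last lia.
by rewrite /part -/F; congr (_ - nth _ _ _)%N; lia.
Qed.

Lemma lambda_of_part : is_part (lambda_of a b alpha beta).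
Proof. by rewrite lambda_ofE; apply: shape_of_part. Qed.

Let nth_lambda k : nth 0%N (lambda_of a b alpha beta) k = row k.
Proof. by rewrite lambda_ofE nth_shape_of // /row ltnn. Qed.

(** Row [s] of [F] becomes row [a - 1 - s] of the complement and puts a zero at
    [b - a + 1 + s - F_s]. The first [r] rows of [F] give the elements of [beta] on the lower side,
    the others the rows outside [alpha] on the right side. *)
Lemma maya_lambda_of : maya (lambda_of a b alpha beta) =1 target a b alpha beta.
Proof.
move=> c; apply: negb_inj; apply/mayaPn/idP => [[k]|].
  rewrite nth_lambda /row; case: ltnP => ka; last by move=> <-; rewrite /target ifT //; lia.
  set s := (a.-1 - k)%N; have sE : s%:Z = a%:Z - 1 - k%:Z by rewrite /s; lia.
  have := F_le_b s => Fb cE.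
  have {}cE : c = b%:Z - a%:Z + 1 + s%:Z - (nth 0%N F s)%:Z by lia.
  rewrite /target ifF; last lia.
  have [sr|sr] := ltnP s r.
    have := durfee s; rewrite sr => sF; rewrite ifT ?negbK; last lia.
    apply/mem_increasing; exists s; last by rewrite -/be; have := F_row sr; lia.
    by have [_ _ <-] := bp.
  have sF : (nth 0 F s <= s)%N by rewrite leqNgt durfee -leqNgt.
  rewrite ifF ?ifT; try lia.
  apply/mem_increasing => -[j jr]; rewrite -/al => jE.
  by have := F_col s jr; lia.
rewrite /target; case: ifP => [ca _|ca]; first by exists `|c|%N; rewrite nth_lambda /row ifF; lia.
case: ifP => [cb|cb].
  rewrite negbK => /mem_increasing[k]; have [_ _ <-] := bp.
  rewrite -/be => kr kE; exists (a.-1 - k)%N; rewrite nth_lambda /row.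
  have ka := leq_trans kr r_le_a; rewrite ifT; last lia.
  rewrite subKn; last lia.
  by have := F_le_b k; have := F_row kr; lia.
(* On the right side a row [s] of [F] with [s - F_s = m - 1] is sought. The value [m - 1] is missing
   from [delta] because [b + 1 - c] is not in [alpha]; the number [j] of entries of [delta] that are
   at least [m] will be the length of row [s = m + j - 1]. *)
case: ifP => // cb' xal; pose m : int := a%:Z + c - b%:Z.
have mneq k : (k < r)%N -> a%:Z - nth 0 al k != m - 1.
  move=> kr; apply: contra xal => /eqP E; apply/mem_increasing; exists k => //.
  by rewrite -/al; rewrite /m in E; lia.
pose j := find (fun x => x < m) delta.
have jr : (j <= r)%N by rewrite -size_delta find_size.
have jlt k : (k < j)%N -> m <= a%:Z - nth 0 al k.
  move=> kj; have := before_find 0 kj; rewrite nth_delta; last exact: leq_trans kj jr.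
  by rewrite ltNge => /negbFE.
have jge : (j < r)%N -> a%:Z - nth 0 al j < m.
  move=> jr'; rewrite -nth_delta //.
  by apply: (@nth_find _ 0 (fun x => x < m)); rewrite has_find size_delta.
pose s := (`|m| + j).-1.
have sE : s%:Z = m + j%:Z - 1 by rewrite /s; lia.
have Fs : nth 0%N F s = j.
  apply/eqP; rewrite eqn_leq; apply/andP; split.
    rewrite leqNgt; apply/negP => jF; have [jr'|jr'] := ltnP j r.
      by have := F_col s jr'; have := jge jr'; have := mneq _ jr'; lia.
    have := durfee r; rewrite ltnn => /negbT.
    by have := part_leq Fp (r := r) (s := s) ltac:(lia); lia.
  case: (posnP j) => [->//|j0]; have j'j : (j.-1 < j)%N by rewrite ltn_predL.
  by have := F_col s (leq_trans j'j jr); have := jlt _ j'j; lia.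
(* For positive [j], [m + j - 1] is at most [delta_(j-1) + j - 1], hence at most [delta_0], which is
   at most [a - 1]. *)
have sa : (s < a)%N.
  case: (posnP j) => [j0|j0]; first by lia.
  have j'j : (j.-1 < j)%N by rewrite ltn_predL.
  have := decreasing_slack delta_dec (i := 0%N) (j := j.-1).
  have j'r := leq_trans j'j jr.
  rewrite size_delta !nth_delta //; last by lia.
  by have := al_bound (k := 0%N); have := jlt _ j'j; lia.
exists (a.-1 - s)%N; rewrite nth_lambda /row ifT; last lia.
rewrite subKn; last lia.
by have := F_le_b s; rewrite Fs /m in sE *; lia.
Qed.

End Boundary.
End Frobenius.

(** * Vacancies and osculations of osculating paths *)

Section LatticePaths.
Local Open Scope ring_scope.
Implicit Types (p q : lpoint) (s : seq (int * int)).

Lemma path_stepP p q : path_step p q ->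
  q = (p.1, p.2 + 1) \/ q = (p.1 - 1, p.2).
Proof. by case/orP => /eqP; [left | right]. Qed.

Section OnePath.
Variables (p0 : int * int) (s : seq (int * int)).
Hypothesis ps : path path_step p0 s.
Let N k := nth p0 (p0 :: s) k.

Lemma path_nth_step k : (k < size s)%N ->
  N k.+1 = ((N k).1, (N k).2 + 1) \/ N k.+1 = ((N k).1 - 1, (N k).2).
Proof. by move=> ks; apply: path_stepP; apply: (pathP p0 ps). Qed.

(** Both kinds of step raise the content by one, so a path meets each diagonal in its range exactly
    once and its points can be indexed by content. *)
Lemma path_nth_content k : (k <= size s)%N -> content (N k) = content p0 + k%:Z.
Proof.
elim: k => [|k IH] ks; first by rewrite /N /=; lia.
have := IH (ltnW ks); rewrite /content.
by case: (path_nth_step ks) => ->; rewrite /=; lia.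
Qed.

Lemma path_memP q : reflect (exists2 k, (k <= size s)%N & N k = q) (q \in p0 :: s).
Proof. by apply: (iffP (nthP p0)) => -[k ks <-]; exists k. Qed.

Lemma path_content_inj p q : p \in p0 :: s -> q \in p0 :: s ->
  content p = content q -> p = q.
Proof.
move=> /path_memP[k ks <-] /path_memP[m ms <-].
by rewrite !path_nth_content // => E; congr N; lia.
Qed.

Lemma path_content_mem c : content p0 <= c <= content p0 + (size s)%:Z ->
  exists2 q : int * int, q \in p0 :: s & content q = c.
Proof.
move=> cb; exists (N `|c - content p0|%N); last by rewrite path_nth_content; lia.
by apply/path_memP; exists `|c - content p0|%N => //; lia.
Qed.

Lemma path_nth_mono k m : (k <= m <= size s)%N ->
  (N m).1 <= (N k).1 /\ (N k).2 <= (N m).2.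
Proof.
elim: m => [|m IH] km; first by have -> : k = 0%N by lia.
have [km'|km'] := leqP k m; last by have -> : k = m.+1 by lia.
have [|H1 H2] := IH; first by lia.
by case: (@path_nth_step m) => [|->|->] /=; [lia | split; lia | split; lia].
Qed.

Lemma path_bounds q : q \in p0 :: s ->
  [/\ (last p0 s).1 <= q.1, q.1 <= p0.1, p0.2 <= q.2 & q.2 <= (last p0 s).2].
Proof.
case/path_memP => k ks <-.
have [|+ +] := @path_nth_mono 0%N k; first by lia.
have [|+ +] := @path_nth_mono k (size s); first by lia.
by rewrite [N (size s)](nth_last p0 (p0 :: s)).
Qed.

Lemma path_next q : q \in p0 :: s -> q != last p0 s ->
  (q.1, q.2 + 1) \in p0 :: s \/ (q.1 - 1, q.2) \in p0 :: s.
Proof.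
case/path_memP => k ks <- kl; have ks' : (k < size s)%N.
  by rewrite ltn_neqAle ks andbT; apply: contra kl => /eqP->; rewrite /N (nth_last p0 (p0 :: s)).
by case: (path_nth_step ks') => <-; [left | right]; apply/path_memP; exists k.+1.
Qed.

Lemma path_prev q : q \in p0 :: s -> q != p0 ->
  (q.1, q.2 - 1) \in p0 :: s \/ (q.1 + 1, q.2) \in p0 :: s.
Proof.
case/path_memP => -[|k] ks <-; first by rewrite eqxx.
move=> _; have Nk : N k \in p0 :: s by apply/path_memP; exists k => //; exact: ltnW.
by case: (path_nth_step ks) => ->; rewrite /= ?addrK ?subrK -surjective_pairing; [left | right].
Qed.

End OnePath.

Lemma count_iota_ge2 (A : pred nat) r : (2 <= count A (iota 0 r))%N ->
  exists k m, [/\ (k < m < r)%N, A k & A m].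
Proof.
elim: r => [//|r IH]; rewrite -(addn1 r) iotaD count_cat /= add0n addn0.
case Ar: (A r); last by rewrite addn0 => /IH[k [m [km Ak Am]]]; exists k, m; split=> //; lia.
move=> c2; have : has A (iota 0 r) by rewrite has_count; lia.
move=> /hasP[k]; rewrite mem_iota => kr Ak.
by exists k, r; split=> //; lia.
Qed.

Lemma count_iota_pair (A : pred nat) k m r : (k < m < r)%N -> A k -> A m ->
  (2 <= count A (iota 0 r))%N.
Proof.
move=> /andP[km mr] Ak Am; rewrite -(subnKC mr) iotaD count_cat -(addn1 m) iotaD count_cat.
rewrite /= add0n Am; have : has A (iota 0 m) by apply/hasP; exists k; rewrite ?mem_iota.
by rewrite has_count; lia.
Qed.

End LatticePaths.

Section FromPaths.
Local Open Scope ring_scope.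
Variables (a b : nat) (alpha beta : {fset int}) (P : seq (seq (int * int))).
Hypotheses (bp : BP a b alpha beta) (opP : OP a b alpha beta P).

Let r := #|` alpha|.
Let X k : int := nth 0 (increasing alpha) k.
Let Y k : int := nth 0 (increasing beta) k.
Let Q k := nth [::] P k.

Let size_P : size P = r. Proof. by case: opP. Qed.
Let pathQ k : (k < r)%N -> Pi_paths a b (X k) (Y k) (Q k).
Proof. by rewrite -size_P; case: opP => _ /(_ k). Qed.

Let X_bound k : (k < r)%N -> 1 <= X k <= a%:Z. Proof. exact: al_bound bp _. Qed.
Let Y_bound k : (k < r)%N -> 1 <= Y k <= b%:Z. Proof. exact: be_bound bp _. Qed.
Let X_lt k m : (k < m < r)%N -> X k < X m. Proof. exact: increasing_lt. Qed.
Let Y_lt k m : (k < m < r)%N -> Y k < Y m.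
Proof. by have [_ _ +] := bp => E; rewrite /r E; exact: increasing_lt. Qed.

(* Adding a point below the start and one to the right of the end makes both
   exceptions in the definition of osculating paths disappear. *)
Let E k : seq (int * int) := (a%:Z + 1, Y k) :: rcons (Q k) (X k, b%:Z + 1).

Let pathE k : (k < r)%N -> path path_step (a%:Z + 1, Y k) (rcons (Q k) (X k, b%:Z + 1)).
Proof.
move=> kr; have [Q' [-> ps lastQ]] := pathQ kr.
by rewrite /= rcons_path ps lastQ /path_step /= addrK !eqxx orbT.
Qed.

Let Q_sub k (p : int * int) : p \in Q k -> p \in E k.
Proof. by move=> pQ; rewrite inE mem_rcons inE pQ !orbT. Qed.

Let Q_bounds k (p : int * int) : (k < r)%N -> p \in Q k ->
  (X k <= p.1 <= a%:Z) && (Y k <= p.2 <= b%:Z).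
Proof.
move=> kr; have [Q' [-> ps lastQ]] := pathQ kr => /(path_bounds ps); rewrite lastQ /=.
by move=> [-> -> -> ->].
Qed.

Let E_cases k (p : int * int) : p \in E k ->
  [\/ p = (a%:Z + 1, Y k), p = (X k, b%:Z + 1) | p \in Q k].
Proof.
by rewrite inE mem_rcons inE => /or3P[/eqP|/eqP|]; [constructor 1|constructor 2|constructor 3].
Qed.

Let E_grid k (p : int * int) : p \in E k -> p.1 <= a%:Z -> p.2 <= b%:Z -> p \in Q k.
Proof. by case/E_cases => [->|->|//] /=; lia. Qed.

Let E_inj k (p q : int * int) : (k < r)%N -> p \in E k -> q \in E k ->
  content p = content q -> p = q.
Proof. by move=> kr; apply: (path_content_inj (pathE kr)). Qed.

Let Q_next k (p : int * int) : (k < r)%N -> p \in Q k ->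
  (p.1, p.2 + 1) \in E k \/ (p.1 - 1, p.2) \in E k.
Proof.
move=> kr pQ; have := path_next (pathE kr) (Q_sub pQ); apply.
by rewrite last_rcons; apply/eqP => pE; have := Q_bounds kr pQ; rewrite pE /=; lia.
Qed.

Let Q_prev k (p : int * int) : (k < r)%N -> p \in Q k ->
  (p.1, p.2 - 1) \in E k \/ (p.1 + 1, p.2) \in E k.
Proof.
move=> kr pQ; have := path_prev (pathE kr) (Q_sub pQ); apply.
by apply/eqP => pE; have := Q_bounds kr pQ; rewrite pE /=; lia.
Qed.

Let E_range k c : (k < r)%N -> Y k - a%:Z - 1 <= c <= b%:Z + 1 - X k ->
  exists2 p : int * int, p \in E k & content p = c.
Proof.
move=> kr cb; apply: (path_content_mem (pathE kr)).
have := path_nth_content (pathE kr) (leqnn _).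
by rewrite (nth_last _ (_ :: _)) /= last_rcons /content /=; lia.
Qed.

Let osc k (p : int * int) : (k.+1 < r)%N -> p \in Q k -> p \in Q k.+1 ->
  [/\ (p.1, p.2 - 1) \in E k, (p.1 - 1, p.2) \in E k,
      (p.1 + 1, p.2) \in E k.+1 & (p.1, p.2 + 1) \in E k.+1].
Proof.
move=> kr pQ pQ'.
have [_ _ /(_ k)] := opP; rewrite size_P => /(_ kr) oscQ.
move/(nthP (0, 0)): (pQ) => [m mQ mE]; move/(nthP (0, 0)): (pQ') => [m' mQ' mE'].
have [] := oscQ m m' p.1 p.2 mQ mQ'; rewrite -?surjective_pairing //.
move=> [m0 prev] [m1 next] prev' next'; split.
- by apply: Q_sub; rewrite -prev mem_nth // prednK // ltnW.
- by apply: Q_sub; rewrite -next mem_nth.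
- case: prev' => [m'0|prev'].
    have [Q' [Q'E _ _]] := pathQ kr; move: mE'; rewrite m'0 -/(Q k.+1) Q'E /= => <- /=.
    by rewrite inE eqxx.
  have [m'0|m'0] := posnP m'.
    have [Q' [Q'E _ _]] := pathQ kr; move: mE'; rewrite m'0 -/(Q k.+1) Q'E /= => <- /=.
    by rewrite inE eqxx.
  by apply: Q_sub; rewrite -prev' mem_nth // prednK // ltnW.
- have [m's|m's] := ltnP m'.+1 (size (Q k.+1)).
    case: next' => [E'|next']; first by move: m's; rewrite /Q E' ltnn.
    by apply: Q_sub; rewrite -next' mem_nth.
  have [Q' [Q'E _ lastQ]] := pathQ kr.
  have : p = (X k.+1, b%:Z).
    have sE : size (Q k.+1) = m'.+1 by apply/eqP; rewrite eqn_leq m's; exact: mQ'.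
    by rewrite -lastQ -(last_cons (0, 0)) -Q'E -nth_last -mE' sE.
  by move=> -> /=; rewrite inE mem_rcons inE eqxx orbT.
Qed.

(** Consecutive paths do not cross. The induction follows the diagonals from the start of path
    [k.+1], whose row [a + 1] is the largest possible. *)
Let E_order k (p q : int * int) : (k.+1 < r)%N -> p \in E k -> q \in E k.+1 ->
  content p = content q -> p.1 <= q.1.
Proof.
move=> kr; have kr' := ltnW kr.
have Xk := X_lt (k := k) (m := k.+1); have Yk := Y_lt (k := k) (m := k.+1).
have Xb := X_bound kr; have Yb := Y_bound kr; have Xb' := X_bound kr'; have Yb' := Y_bound kr'.
suff H (n : nat) : forall p q : int * int, p \in E k -> q \in E k.+1 -> content p = content q ->
    content q = Y k.+1 - a%:Z - 1 + n%:Z -> p.1 <= q.1.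
  move=> pE qE pq; apply: (H (absz (content q - (Y k.+1 - a%:Z - 1))%R)) => //.
  by case/E_cases: qE => [->|->|/(Q_bounds kr)]; rewrite /content /=; lia.
elim: n => [|n IH] {}p {}q pE qE pq qn.
  have -> : q = (a%:Z + 1, Y k.+1).
    by apply: (E_inj kr qE); rewrite ?inE ?eqxx // qn /content /=; lia.
  by case/E_cases: pE => [->|->|/(Q_bounds kr')] /=; lia.
have qb : content q <= b%:Z + 1 - X k.+1.
  by case/E_cases: qE => [->|->|/(Q_bounds kr)]; rewrite /content /=; lia.
have [p' p'E cp'] : exists2 p' : int * int, p' \in E k & content p' = content p - 1.
  by apply: E_range => //; lia.
have [q' q'E cq'] : exists2 q' : int * int, q' \in E k.+1 & content q' = content q - 1.
  by apply: E_range => //; lia.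
have p'q' : p'.1 <= q'.1 by apply: IH => //; lia.
have next t (u v : int * int) : (t < r)%N -> u \in E t -> v \in E t -> content u = content v - 1 ->
    v = (u.1, u.2 + 1) \/ v = (u.1 - 1, u.2).
  move=> tr uE vE uv; case: (path_next (pathE tr) uE) => [|uE'|uE'].
  - rewrite last_rcons; apply/eqP => uE'.
    have := X_bound tr; have := Y_bound tr.
    by case/E_cases: vE uv => [->|->|/(Q_bounds tr)]; rewrite uE' /content /=; lia.
  - by left; apply: (E_inj tr) => //; move: uv; rewrite /content /=; lia.
  - by right; apply: (E_inj tr) => //; move: uv; rewrite /content /=; lia.
have pn := next k p' p kr' p'E pE cp'; have qn' := next k.+1 q' q kr q'E qE cq'.
(* A strict gap in the rows cannot be reversed in one step; at a common point the osculation
   condition sends path [k] upwards. *)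
have [pq'|pq'] := eqVneq p'.1 q'.1; last first.
  have {}pq' : p'.1 < q'.1 by rewrite lt_neqAle pq'.
  by case: pn => ->; case: qn' => -> /=; lia.
have {}pq' : p' = q'.
  case: p' q' pq' cp' cq' {pn qn' next IH p'E q'E p'q'} => [i j] [i' j'] /=.
  by rewrite /content /= => -> ? ?; congr (_, _); move: pq; rewrite /content; lia.
have q'Q : q' \in Q k.+1.
  case/E_cases: q'E => // q'E.
    have := E_cases p'E; rewrite pq' q'E => -[[]|[]|/(Q_bounds kr')] /=; lia.
  have := E_cases p'E; rewrite pq' q'E => -[[]|[]|/(Q_bounds kr')] /=; lia.
have p'Q : p' \in Q k.
  by apply: E_grid => //; rewrite pq'; have := Q_bounds kr q'Q; lia.
have [_ top _ right_] := osc kr p'Q (etrans (congr1 (mem _) pq') q'Q : p' \in Q k.+1).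
have -> : p = (p'.1 - 1, p'.2).
  by apply: (E_inj kr') => //; move: cp'; rewrite /content /=; lia.
by case: qn' => -> /=; rewrite pq'; lia.
Qed.

Let E_content k (p : int * int) : (k < r)%N -> p \in E k ->
  Y k - a%:Z - 1 <= content p <= b%:Z + 1 - X k.
Proof.
move=> kr; have := X_bound kr; have := Y_bound kr.
by move=> ? ? /E_cases[->|->|/(Q_bounds kr)]; rewrite /content /=; lia.
Qed.

Let E_at k m (q : int * int) : (k <= m < r)%N -> q \in E m ->
  exists2 p : int * int, p \in E k & content p = content q.
Proof.
move=> km qE; have := E_content (k := m) ltac:(lia) qE => qb.
apply: E_range; first by lia.
move: km; rewrite leq_eqVlt => /andP[/orP[/eqP->//|km] mr].
by have := X_lt (k := k) (m := m); have := Y_lt (k := k) (m := m); lia.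
Qed.

Let E_le k m (p q : int * int) : (k <= m < r)%N -> p \in E k -> q \in E m ->
  content p = content q -> p.1 <= q.1.
Proof.
elim: m q => [|m IH] q km pE qE pq.
  have k0 : k = 0%N by lia.
  by rewrite (E_inj (k := k) _ pE _ pq) ?k0 //; lia.
have [km'|km'] := leqP k m; last first.
  have kE : k = m.+1 by lia.
  by rewrite (E_inj (k := k) _ pE _ pq) ?kE //; lia.
have [q' q'E cq'] := E_at (k := m) (m := m.+1) ltac:(lia) qE.
have := E_order (k := m) ltac:(lia) q'E qE cq'.
by have := IH q' ltac:(lia) pE q'E (etrans pq (esym cq')); lia.
Qed.

(** By the order along diagonals, all paths between two that meet at [p] also pass through [p]. With
    three of them, the middle one would have to leave [p] both to the right and upwards. *)
Let common_consecutive k m (p : int * int) : (k < m < r)%N -> p \in Q k -> p \in Q m -> m = k.+1.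
Proof.
move=> km pk pm; have [pa pb] : p.1 <= a%:Z /\ p.2 <= b%:Z.
  by have := Q_bounds (k := k) ltac:(lia) pk; lia.
have mid t : (k <= t <= m)%N -> p \in Q t.
  move=> kt; have [q qE cq] := E_at (k := t) (m := m) ltac:(lia) (Q_sub pm).
  have := E_le (k := k) (m := t) ltac:(lia) (Q_sub pk) qE (esym cq).
  have := E_le (k := t) (m := m) ltac:(lia) qE (Q_sub pm) cq => le1 le2.
  have qp : q = p.
    case: q p cq le1 le2 {pa pb pk pm qE} => [i j] [i' j'].
    by rewrite /content /= => ? ? ?; congr (_, _); lia.
  by apply: E_grid => //; rewrite -qp.
apply/eqP; rewrite eqn_leq; apply/andP; split; last by lia.
rewrite leqNgt; apply/negP => k2.
have [_ _ _ rt] := osc (k := k) ltac:(lia) (mid k ltac:(lia)) (mid k.+1 ltac:(lia)).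
have [_ tp _ _] := osc (k := k.+1) ltac:(lia) (mid k.+1 ltac:(lia)) (mid k.+2 ltac:(lia)).
have := E_inj (k := k.+1) ltac:(lia) rt tp ltac:(rewrite /content /=; lia).
by case; lia.
Qed.

Let right_used (p : int * int) : bool :=
  has (fun k => (p \in E k) && ((p.1, p.2 + 1) \in E k)) (iota 0 r).
Let bottom_used (p : int * int) : bool :=
  has (fun k => (p \in E k) && ((p.1 + 1, p.2) \in E k)) (iota 0 r).

Let npathsE (p : int * int) : npaths_at P p = count (fun k => p \in Q k) (iota 0 r).
Proof.
rewrite /npaths_at -size_P -[in LHS](mkseq_nth [::] P) /mkseq count_map.
by apply: eq_count.
Qed.

(** At a vacancy none of the four edges is used and at an osculation all are. A point on a single
    path has one used edge among left and bottom, and one among top and right. *)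
Let vertex_rule (p : int * int) : p \in grid a b ->
  if p \in Z a b P then
    [/\ bottom_used p = right_used (p.1, p.2 - 1), right_used p = right_used (p.1, p.2 - 1)
      & bottom_used (p.1 - 1, p.2) = right_used (p.1, p.2 - 1)]
  else bottom_used p = ~~ right_used (p.1, p.2 - 1) /\
       right_used p = ~~ bottom_used (p.1 - 1, p.2).
Proof.
move=> pg; have pZ : (p \in Z a b P) = (npaths_at P p != 1%N).
  by move: pg; rewrite !inE => ->; rewrite /vacancy /osculation; lia.
move: (pg); rewrite mem_grid => pb.
have inQ k : p \in E k -> p \in Q k by move=> /E_grid; apply; lia.
have lE k : ((p.1, p.2 - 1) \in E k) && ((p.1, p.2 - 1 + 1) \in E k) =
            ((p.1, p.2 - 1) \in E k) && (p \in E k).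
  by rewrite subrK -surjective_pairing.
have tE k : ((p.1 - 1, p.2) \in E k) && ((p.1 - 1 + 1, p.2) \in E k) =
            ((p.1 - 1, p.2) \in E k) && (p \in E k).
  by rewrite subrK -surjective_pairing.
have used k : (k < r)%N -> p \in E k ->
    ((p.1 + 1, p.2) \in E k) = ((p.1, p.2 - 1) \notin E k) /\
    ((p.1, p.2 + 1) \in E k) = ((p.1 - 1, p.2) \notin E k).
  move=> kr pE; split.
    have [l|bt] := Q_prev kr (inQ _ pE).
      rewrite l; apply/negP => bt.
      by have := E_inj kr l bt ltac:(rewrite /content /=; lia); case; lia.
    rewrite bt; apply/esym/negP => l.
    by have := E_inj kr l bt ltac:(rewrite /content /=; lia); case; lia.
  have [rt|t] := Q_next kr (inQ _ pE).
    rewrite rt; apply/esym/negP => t.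
    by have := E_inj kr rt t ltac:(rewrite /content /=; lia); case; lia.
  rewrite t; apply/negP => rt.
  by have := E_inj kr rt t ltac:(rewrite /content /=; lia); case; lia.
have iota_r k : (k \in iota 0 r) = (k < r)%N by rewrite mem_iota.
rewrite pZ npathsE; case: eqP => [c1|c1] /=.
  have /hasP[k] : has (fun k => p \in Q k) (iota 0 r) by rewrite has_count c1.
  rewrite iota_r => kr pk.
  have only m : (m < r)%N -> p \in E m -> m = k.
    move=> mr /inQ pm; case: (ltngtP m k) => // [mk|km].
      by have := @count_iota_pair (fun k => p \in Q k) m k r ltac:(lia) pm pk; rewrite c1.
    by have := @count_iota_pair (fun k => p \in Q k) k m r ltac:(lia) pk pm; rewrite c1.
  have hasE (A : pred nat) : has (fun m => (p \in E m) && A m) (iota 0 r) = A k.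
    apply/hasP/idP => [[m]|Ak]; last by exists k; rewrite ?iota_r ?(Q_sub pk).
    by rewrite iota_r => mr /andP[/(only _ mr)->].
  have [Hb Hr] := used k kr (Q_sub pk).
  have -> : right_used (p.1, p.2 - 1) = ((p.1, p.2 - 1) \in E k).
    by rewrite -[RHS](hasE (fun m => (p.1, p.2 - 1) \in E m)); apply: eq_has => m; rewrite lE andbC.
  have -> : bottom_used (p.1 - 1, p.2) = ((p.1 - 1, p.2) \in E k).
    by rewrite -[RHS](hasE (fun m => (p.1 - 1, p.2) \in E m)); apply: eq_has => m; rewrite tE andbC.
  by rewrite /bottom_used /right_used !hasE.
have [c0|c0] := posnP (count (fun k => p \in Q k) (iota 0 r)).
  have none (A : pred nat) : has (fun m => (p \in E m) && A m) (iota 0 r) = false.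
    apply/hasP => -[m mr /andP[/inQ pm _]].
    by have : has (fun k => p \in Q k) (iota 0 r) by [apply/hasP; exists m]; rewrite has_count c0.
  have -> : right_used (p.1, p.2 - 1) = false.
    by rewrite -[RHS](none (fun m => (p.1, p.2 - 1) \in E m)); apply: eq_has => m; rewrite lE andbC.
  have -> : bottom_used (p.1 - 1, p.2) = false.
    by rewrite -[RHS](none (fun m => (p.1 - 1, p.2) \in E m)); apply: eq_has => m; rewrite tE andbC.
  by rewrite /bottom_used /right_used !none.
have /count_iota_ge2[k [m [km pk pm]]] : (2 <= count (fun k => p \in Q k) (iota 0 r))%N by lia.
have mE := common_consecutive km pk pm; rewrite {m}mE in km pm.
have [l t bt rt] := osc (k := k) ltac:(lia) pk pm.
have in1 : k \in iota 0 r by rewrite iota_r; lia.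
have in2 : k.+1 \in iota 0 r by rewrite iota_r; lia.
have -> : right_used (p.1, p.2 - 1) by apply/hasP; exists k; rewrite // lE l Q_sub.
split.
- by apply/hasP; exists k.+1; rewrite // bt Q_sub.
- by apply/hasP; exists k.+1; rewrite // rt Q_sub.
- by apply/hasP; exists k; rewrite // tE t Q_sub.
Qed.

Let Z_grid : {subset Z a b P <= grid a b}.
Proof. by move=> p; rewrite !inE => /andP[]. Qed.

(** Induction on the coordinate sum: by [vertex_rule] the edges to the left of and above a point
    determine those to the right and below. It starts on row 0 and column 0, which no path uses. *)
Let bits_used n : forall p : int * int, p.1 + p.2 = n%:Z -> 0 <= p.1 <= a%:Z -> 0 <= p.2 <= b%:Z ->
  (1 <= p.1 -> right_bit (Z a b P) p = right_used p) /\
  (1 <= p.2 -> bottom_bit (Z a b P) p = ~~ bottom_used p).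
Proof.
elim/ltn_ind: n => n IH p pn p1 p2.
have [p10|p10] := leP 1 p.1; last first.
  split=> [|p21]; first by lia.
  have pE : p = (0, p.2) by case: (p) p1 p10 => i j /= *; congr (_, _); lia.
  rewrite pE (bottom_bit_top Z_grid) //; apply/esym/hasP => -[k].
  rewrite mem_iota => kr /andP[+ _]; have := X_bound kr.
  by move=> ? /E_cases[[]|[]|/(Q_bounds kr)] /=; lia.
have [p20|p20] := leP 1 p.2; last first.
  split=> [_|]; last by lia.
  have pE : p = (p.1, 0) by case: (p) p2 p20 => i j /= *; congr (_, _); lia.
  rewrite pE (right_bit_left Z_grid) //; apply/esym/hasP => -[k].
  rewrite mem_iota => kr /andP[+ _]; have := Y_bound kr.
  by move=> ? /E_cases[[]|[]|/(Q_bounds kr)] /=; lia.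
have pg : p \in grid a b by rewrite mem_grid; lia.
have [|||/(_ p10) Hl _] := IH n.-1 ltac:(lia) (p.1, p.2 - 1); rewrite /=; try lia.
have [|||_ /(_ p20) Ht] := IH n.-1 ltac:(lia) (p.1 - 1, p.2); rewrite /=; try lia.
have := vertex_rule pg; rewrite bottom_bitE right_bitE Hl Ht.
case: ifP => _ => [[-> -> ->]|[-> ->]]; rewrite ?addbT ?addbF ?negbK //.
Qed.

Lemma vertex_set_Z : vertex_set a b alpha beta (Z a b P).
Proof.
split=> [|/= p pZ|].
- exact: Z_grid.
- have pg := Z_grid pZ; have := vertex_rule pg; rewrite pZ => -[_ _ Hv].
  move: pg; rewrite mem_grid => pg.
  have [|||+ _] := @bits_used (absz (p.1 + p.2 - 1)%R) (p.1, p.2 - 1); rewrite /=; try lia.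
  move=> ->; last by lia.
  have [|||_] := @bits_used (absz (p.1 + p.2 - 1)%R) (p.1 - 1, p.2); rewrite /=; try lia.
  by move=> ->; [rewrite Hv; case: right_used | lia].
(* The added end points of [E k] make the edge below [(a, Y k)] and the edge to the right of
   [(X k, b)] used. *)
apply/(vertex_setP _ _ Z_grid); split=> [j jb|i ia].
  have [|||_ ->] := @bits_used (absz (a%:Z + j)%R) (a%:Z, j); rewrite /=; try lia.
  congr negb; apply/hasP/mem_increasing => [[k]|[k kr kE]].
    rewrite mem_iota => kr /andP[_ /E_cases[[->]|[]|/(Q_bounds kr)]] /=; try lia.
    by exists k => //; have [_ _ <-] := bp.
  have {}kr : (k < r)%N by rewrite /r; have [_ _ ->] := bp.
  exists k; first by rewrite mem_iota.
  apply/andP; split; last by rewrite -kE; exact: mem_head.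
  by have [Q' [QE _ _]] := pathQ kr; rewrite Q_sub // QE -kE; exact: mem_head.
have [|||+ _] := @bits_used (absz (i + b%:Z)%R) (i, b%:Z); rewrite /=; try lia.
move=> ->; last by lia.
apply/hasP/mem_increasing => [[k]|[k kr kE]].
  rewrite mem_iota => kr /andP[_ /E_cases[[]|[->]|/(Q_bounds kr)]] /=; try lia.
  by exists k.
exists k; first by rewrite mem_iota.
apply/andP; split; last by rewrite -kE in_cons mem_rcons mem_head orbT.
by have [Q' [QE _ lastQ]] := pathQ kr; rewrite Q_sub // QE -kE -[(_, _)]lastQ mem_last.
Qed.

End FromPaths.

(** * Osculating paths with prescribed vacancies and osculations *)

Section ToPaths.
Local Open Scope ring_scope.
Variables (a b : nat) (alpha beta : {fset int}) (S : {fset int * int}).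
Hypotheses (bp : BP a b alpha beta) (vsS : vertex_set a b alpha beta S).

Let r := #|` alpha|.
Let Y k : int := nth 0 (increasing beta) k.

Let Y_bound k : (k < r)%N -> 1 <= Y k <= b%:Z. Proof. exact: be_bound bp _. Qed.
Let Y_lt k m : (k < m < r)%N -> Y k < Y m.
Proof. by have [_ _ +] := bp => E; rewrite /r E; exact: increasing_lt. Qed.

Let left_used (p : int * int) : bool := right_bit S (p.1, p.2 - 1).
Let bottom_used (p : int * int) : bool := ~~ bottom_bit S p.
Let right_used (p : int * int) : bool := right_bit S p.
Let top_used (p : int * int) : bool := ~~ bottom_bit S (p.1 - 1, p.2).

Let S_grid : {subset S <= grid a b}. Proof. by case: vsS. Qed.

Let vertex_in (p : int * int) : p \in S ->
  [/\ bottom_used p = left_used p, right_used p = left_used p & top_used p = left_used p].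
Proof.
move=> pS; have [_ /(_ p pS) + _] := vsS.
rewrite /bottom_used /right_used /top_used /left_used (bottom_bitE S p) (right_bitE S p) pS.
by case: right_bit; case: bottom_bit.
Qed.

Let vertex_out (p : int * int) : p \notin S ->
  bottom_used p = ~~ left_used p /\ right_used p = ~~ top_used p.
Proof.
move=> /negbTE pS; rewrite /bottom_used /right_used /top_used /left_used.
by rewrite (bottom_bitE S p) (right_bitE S p) pS !addbF negbK.
Qed.

Let left_used1 i : 1 <= i -> left_used (i, 1) = false.
Proof. by move=> i1; rewrite /left_used /= subrr (right_bit_left S_grid). Qed.

Let top_used1 j : 1 <= j -> top_used (1, j) = false.
Proof. by move=> j1; rewrite /top_used /= subrr (bottom_bit_top S_grid). Qed.

Let bottom_usedE j : 1 <= j <= b%:Z -> bottom_used (a%:Z, j) = (j \in beta).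
Proof.
move=> jb; have [_ _ /(vertex_setP _ _ S_grid)[H _]] := vsS.
by rewrite /bottom_used H // negbK.
Qed.

Let right_usedE i : 1 <= i <= a%:Z -> right_used (i, b%:Z) = (i \in alpha).
Proof. by move=> ia; have [_ _ /(vertex_setP _ _ S_grid)[_ H]] := vsS; apply: H. Qed.

(* A point together with whether it is entered from the left or from below.
   Past column [b] a path continues to the right forever. *)
Definition walker : Type := ((int * int) * bool)%type.

(* At an osculation both outgoing edges are used: the path coming from the left
   turns up and the one coming from below turns right, so they do not cross. *)
Let goes_up (s : walker) : bool :=
  (s.1.2 <= b%:Z) && (if s.2 then top_used s.1 else ~~ right_used s.1).

Let nxt (s : walker) : walker :=
  if goes_up s then ((s.1.1 - 1, s.1.2), false) else ((s.1.1, s.1.2 + 1), true).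

(** The invariant of a walk: it has entered its point along a used edge, and beyond column [b] it
    runs to the right in a row of [alpha]. *)
Let used (s : walker) : Prop :=
  [/\ 1 <= s.1.1 <= a%:Z, 1 <= s.1.2,
      s.1.2 <= b%:Z -> if s.2 then left_used s.1 else bottom_used s.1
    & b%:Z < s.1.2 -> s.2 && (s.1.1 \in alpha)].

Let nxt_content s : content (nxt s).1 = content s.1 + 1.
Proof. by rewrite /nxt /content; case: goes_up => /=; lia. Qed.

Let nxt_used s : used s -> used (nxt s).
Proof.
case: s => [[i j] d] [/= ia j1 inb outb]; rewrite /nxt /goes_up /=.
have [jb|jb] := leP j b%:Z; last first.
  have /andP[_ ial] := outb jb.
  by split=> /=; rewrite ?ial; lia.
have {outb} := inb jb => {}inb /=.
have out : top_used (i, j) || right_used (i, j).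
  have [/vertex_in[E1 E2 E3]|/vertex_out[E1 E2]] := boolP ((i, j) \in S).
    by rewrite E3; case: d inb; rewrite ?E1 => ->.
  by rewrite E2 orbN.
have [up|nup] := boolP (if d then _ else _).
  have tu : top_used (i, j) by case: d up {inb} => // /negbTE rf; move: out; rewrite rf orbF.
  have i1 : i != 1 by apply/eqP => iE; move: tu; rewrite iE top_used1.
  by split=> /=; [lia | lia | move=> _ | lia].
have ru : right_used (i, j).
  by case: d nup {inb} => [/negbTE tf|]; [move: out; rewrite tf | rewrite negbK].
split=> //=; [lia | by rewrite /left_used /= addrK | move=> jb'].
have jE : j = b%:Z by lia.
by rewrite -right_usedE // -jE.
Qed.

(* The order of the edges along a half-diagonal. *)
Let pos (s : walker) : int := s.1.1 *+ 2 + (~~ s.2)%:Z.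

Let pos_nxt s : pos (nxt s) <= s.1.1 *+ 2.
Proof. by rewrite /nxt /pos; case: goes_up => /=; lia. Qed.

(** Different rows stay in order because a step moves up at most one row. In equal rows the walks
    meet, entering from the left and from below; the point then lies in [S], and they turn up and
    right respectively. *)
Let nxt_lt s s' : used s -> used s' -> content s.1 = content s'.1 ->
  pos s < pos s' -> pos (nxt s) < pos (nxt s').
Proof.
case: s s' => [[i j] d] [[i' j'] d'] us us' cs ps.
have [ii|ii] := ltP i i'.
  by apply: (le_lt_trans (pos_nxt _)); rewrite /nxt /pos; case: goes_up => /=; lia.
have [iE [dE d'E]] : i' = i /\ d = true /\ d' = false.
  by move: ps; rewrite /pos /=; case: (d); case: (d') => /=; lia.
have jE : j' = j by move: cs; rewrite /content /=; lia.
rewrite {}iE {}jE {}dE {}d'E in us us' ps *.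
case: us us' => /= ia j1 lu _ [/= _ _ bu outb].
have jb : j <= b%:Z by rewrite leNgt; apply/negP => /outb.
have {}lu := lu jb; have {}bu := bu jb.
have ijS : (i, j) \in S by apply: contraT => /vertex_out[]; rewrite lu bu.
have [_ ru tu] := vertex_in ijS.
by rewrite /nxt /goes_up /= jb ru tu lu /pos /=; lia.
Qed.

Let st k m : walker := iter m nxt ((a%:Z, Y k), false).

Let st_used k m : (k < r)%N -> used (st k m).
Proof.
move=> kr; elim: m => [|m IH]; last exact: nxt_used.
have := Y_bound kr => Yb; split=> /=; [|lia| |lia].
  by have [+ _ _] := bp => /fsubset_leq_card; have := al_bound bp kr; lia.
move=> _; rewrite bottom_usedE //; apply/mem_increasing; exists k => //.
by have [_ _ <-] := bp.
Qed.

Let st_content k m : content (st k m).1 = Y k - a%:Z + m%:Z.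
Proof. by elim: m => [|m IH]; rewrite ?nxt_content ?IH /content /=; lia. Qed.

Let st_lt k k' m m' : (k < k' < r)%N -> content (st k m).1 = content (st k' m').1 ->
  pos (st k m) < pos (st k' m').
Proof.
move=> kk'; have Ylt := Y_lt kk'.
have kr : (k < r)%N by lia.
have k'r : (k' < r)%N by lia.
(* At [m' = 0] the walk [k'] enters row [a] from below, at position [2a + 1]. The walk [k] has
   already made a step, since [Y k < Y k'], and is at position at most [2a]. *)
elim: m' m => [|m' IH] m; rewrite !st_content => mm'.
  case: m mm' => [|m] mm'; first by lia.
  have [+ _ _ _] := st_used m kr; have := pos_nxt (st k m).
  by rewrite /= {3}/pos /=; lia.
case: m mm' => [|m] mm'; first by lia.
have cm : content (st k m).1 = content (st k' m').1 by rewrite !st_content; lia.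
by rewrite /=; apply: nxt_lt (IH m cm) => //; apply: st_used.
Qed.

Let st_row k m n : (k < r)%N -> (m <= n)%N -> b%:Z < (st k m).1.2 ->
  (st k n).1.1 = (st k m).1.1 /\ b%:Z < (st k n).1.2.
Proof.
move=> kr /subnKC <-; elim: (n - m)%N => [|t IH] bm; first by rewrite addn0.
have [IH1 IH2] := IH bm; rewrite addnS /=.
by rewrite /nxt /goes_up leNgt IH2 /=; split=> //; lia.
Qed.

Let st_exit k m : (k < r)%N -> (a + b <= m)%N -> b%:Z < (st k m).1.2.
Proof.
move=> kr mab; have := st_content k m; have [] := st_used m kr.
by have := Y_bound kr; rewrite /content; lia.
Qed.

(** The walk [st k] never stops; the path proper is its part in the columns up to [b], which it has
    left after [a + b] steps. *)
Let len k : nat := find (fun m => b%:Z < (st k m).1.2) (iota 0 (a + b).+1).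

Let lt_len k m : (k < r)%N -> (m < len k)%N = ((st k m).1.2 <= b%:Z).
Proof.
move=> kr; have hasb : has (fun m => b%:Z < (st k m).1.2) (iota 0 (a + b).+1).
  by apply/hasP; exists (a + b)%N; [rewrite mem_iota; lia | apply: st_exit].
have lenb : (len k < (a + b).+1)%N by rewrite -[X in (_ < X)%N](size_iota 0) -has_find.
rewrite leNgt; apply/idP/negP => [ml|mb].
  have := before_find 0%N ml; rewrite nth_iota; last lia.
  by move=> ->.
rewrite ltnNge; apply/negP => lm; apply: mb.
have := nth_find 0%N hasb; rewrite -/(len k) nth_iota // add0n => lb.
by have [] := st_row kr lm lb.
Qed.

Let len_gt0 k : (k < r)%N -> (0 < len k)%N.
Proof. by move=> kr; rewrite lt_len //=; have := Y_bound kr; lia. Qed.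

Let X k : int := (st k (len k).-1).1.1.

Let st_last k : (k < r)%N -> st k (len k) = ((X k, b%:Z + 1), true) /\
  (st k (len k).-1).1 = (X k, b%:Z).
Proof.
move=> kr; have l0 := len_gt0 kr.
have := lt_len (len k).-1 kr; rewrite ltn_predL l0 => /esym.
have := lt_len (len k) kr; rewrite ltnn => /esym.
rewrite -[in st k (len k)](prednK l0) /= /X /nxt; case: goes_up => /= [|lb lb']; first by lia.
have jE : (st k (len k).-1).1.2 = b%:Z by lia.
by rewrite jE; split=> //; rewrite -[in RHS]jE -surjective_pairing.
Qed.

Let X_alpha k : (k < r)%N -> X k \in alpha.
Proof.
move=> kr; have [_ _ _] := st_used (len k) kr; have [-> _] := st_last kr.
by move=> /=; apply; lia.
Qed.

Let X_lt k k' : (k < k' < r)%N -> X k < X k'.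
Proof.
move=> kk'; have Ylt := Y_lt kk'.
have kr : (k < r)%N by lia.
have k'r : (k' < r)%N by lia.
(* Both walks are compared on one diagonal beyond the right side, where each stays in the row of its
   exit; the shift by [Y k' - Y k] equalizes the contents. *)
pose m' := (a + b)%N; pose m := (m' + absz (Y k' - Y k)%R)%N.
have := st_lt (m := m) (m' := m') kk' ltac:(rewrite !st_content /m; lia).
have lenle t n : (t < r)%N -> (a + b <= n)%N -> (len t <= n)%N.
  by move=> tr abn; rewrite leqNgt lt_len // -ltNge; apply: st_exit.
have row t n : (t < r)%N -> (a + b <= n)%N -> (st t n).1.1 = X t /\ (st t n).2 = true.
  move=> tr abn; have [-> lb] := st_row tr (lenle _ _ tr abn) ltac:(rewrite (st_last tr).1 /=; lia).
  rewrite (st_last tr).1; split=> //; have [_ _ _ /(_ lb)/andP[]] := st_used n tr; done.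
have [Ek dk] := row k m kr ltac:(rewrite /m /m'; lia).
have [Ek' dk'] := row k' m' k'r (leqnn _).
by rewrite /pos Ek Ek' dk dk' /=; lia.
Qed.

(** The exit rows are [r] strictly increasing elements of [alpha], which has [r] elements. *)
Let X_increasing k : (k < r)%N -> X k = nth 0 (increasing alpha) k.
Proof.
move=> kr; suff <- : mkseq X r = increasing alpha by rewrite nth_mkseq.
have Xs : sorted <%R (mkseq X r).
  apply/(sortedP 0) => i; rewrite size_mkseq => ir.
  by rewrite !nth_mkseq ?(ltnW ir) //; apply: X_lt; lia.
apply: lt_sorted_eq (increasing_sorted _) _ => //.
have [|||_ //] := @uniq_min_size _ (mkseq X r) (increasing alpha).
- exact: lt_sorted_uniq Xs.
- by move=> x /mapP[i]; rewrite mem_iota mem_sort => ir ->; apply: X_alpha.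
- by rewrite size_mkseq size_sort.
Qed.

Let Q k : seq (int * int) := mkseq (fun m => (st k m).1) (len k).

Definition traced_paths : seq (seq (int * int)) := mkseq Q r.

Let nth_Q k m : (m < len k)%N -> nth (0, 0) (Q k) m = (st k m).1.
Proof. by move=> ml; rewrite nth_mkseq. Qed.

Let nxt_step s : path_step s.1 (nxt s).1.
Proof. by rewrite /nxt /path_step; case: goes_up => /=; rewrite eqxx ?orbT. Qed.

Let Q_path k : (k < r)%N ->
  Pi_paths a b (nth 0 (increasing alpha) k) (Y k) (Q k).
Proof.
move=> kr; exists (mkseq (fun m => (st k m.+1).1) (len k).-1).
have QE : Q k = (a%:Z, Y k) :: mkseq (fun m => (st k m.+1).1) (len k).-1.
  rewrite /Q -[in LHS](prednK (len_gt0 kr)) /mkseq /= -[1%N]addn0 iotaDl -map_comp.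
  by congr (_ :: _); apply: eq_map => m /=; rewrite add1n.
split=> //.
  apply/(pathP (0, 0)) => i; rewrite size_mkseq => il.
  by rewrite -QE nth_Q ?nth_mkseq //; lia.
rewrite -X_increasing // -(st_last kr).2 -nth_Q ?ltn_predL ?len_gt0 //.
by rewrite -(last_cons (0, 0)) -QE -nth_last size_mkseq.
Qed.

Let same_point k k' m m' : (k < k' < r)%N -> (st k m).1 = (st k' m').1 ->
  (st k m).2 /\ ~~ (st k' m').2.
Proof.
move=> kk' E; have := st_lt kk' (congr1 content E).
by rewrite /pos E; case: (_.2); case: (_.2) => //=; lia.
Qed.

Let Q_osculating k : (k.+1 < r)%N -> osculating (Q k) (Q k.+1).
Proof.
move=> k1r m m' i j; rewrite !size_mkseq => mQ mQ'.
rewrite (nth_Q mQ) (nth_Q mQ') => E E'.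
have kr := ltnW k1r; have kk' : (k < k.+1 < r)%N by rewrite ltnSn.
have [d d'] := same_point kk' (etrans E (esym E')).
have jb : j <= b%:Z by have := lt_len m kr; rewrite mQ E.
have [_ _ + _] := st_used m kr; have [_ _ + _] := st_used m' k1r.
rewrite E E' d (negbTE d') /= => /(_ jb) bu /(_ jb) lu.
(* Outside [S] exactly one of the left and bottom edges is used, whereas here both are. *)
have ijS : (i, j) \in S by apply: contraT => /vertex_out[]; rewrite lu bu.
have [_ ru tu] := vertex_in ijS; rewrite lu in ru tu.
have next : (st k m.+1).1 = (i - 1, j).
  by rewrite /= /nxt /goes_up E d tu jb.
have next' : (st k.+1 m'.+1).1 = (i, j + 1).
  by rewrite /= /nxt /goes_up E' (negbTE d') ru jb.
split.
- case: m E d mQ {next} => // m + + mQ; rewrite /= nth_Q; last exact: ltnW.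
  by rewrite /nxt; case: goes_up => //= -[<- <-] _; rewrite addrK -surjective_pairing.
- have ml : (m.+1 < len k)%N by rewrite lt_len // next.
  by split; rewrite ?nth_Q.
- case: m' E' d' mQ' {next'} => [|m'] + + mQ'; first by left.
  rewrite /= nth_Q; last exact: ltnW.
  by rewrite /nxt; case: goes_up => //= -[<- <-] _; right; rewrite subrK -surjective_pairing.
- have [ml|ml] := ltnP m'.+1 (len k.+1); first by right; rewrite nth_Q.
  by left; apply/eqP; rewrite eqn_leq mQ'.
Qed.

Lemma traced_paths_OP : OP a b alpha beta traced_paths.
Proof.
split=> [|k|k]; rewrite size_mkseq // => kr; rewrite !nth_mkseq ?(ltnW kr) //.
- exact: Q_path.
- exact: Q_osculating.
Qed.

(** Every used edge lies on a walk: it is traced back along used edges to the lower side, with the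
    distance from the lower left corner decreasing. *)
Let covered n : forall p d, 1 <= p.1 <= a%:Z -> 1 <= p.2 <= b%:Z ->
  (if d then left_used p else bottom_used p) -> p.2 + a%:Z - p.1 = n%:Z ->
  exists k m, (k < r)%N /\ st k m = (p, d).
Proof.
elim: n => [|n IH] [i j] d /= ia jb; first by lia.
case: d => [lu|bu] ijn.
  have j1 : j != 1 by apply/eqP => jE; move: lu; rewrite jE left_used1 //; lia.
  have ru : right_used (i, j - 1) by exact: lu.
  have next d : goes_up ((i, j - 1), d) = false ->
      (if d then left_used (i, j - 1) else bottom_used (i, j - 1)) ->
      exists k m, (k < r)%N /\ st k m = ((i, j), true).
    move=> up dused; have [|||k [m [kr E]]] := IH (i, j - 1) d _ _ dused; rewrite /=; try lia.
    by exists k, m.+1; split=> //=; rewrite E /nxt up /= subrK.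
  (* A walk that comes from below takes the used right edge. If none does, the point is outside [S],
     its left edge is used and its top edge is not, so the walk from the left continues to the
     right. *)
  have [bu|bu] := boolP (bottom_used (i, j - 1)).
    by apply: (next false); rewrite ?/goes_up //= ru andbF.
  have nS : (i, j - 1) \notin S.
    by apply/negP => /vertex_in[E1 E2 _]; move: bu; rewrite E1 -E2 ru.
  have [E1 E2] := vertex_out nS; apply: (next true).
    by rewrite /goes_up /=; move: E2; rewrite ru; case: top_used; rewrite ?andbF.
  by move: bu; rewrite E1 negbK.
have [iE|iE] := eqVneq i a%:Z.
  move: bu; rewrite iE bottom_usedE // => /mem_increasing[k kr kE].
  exists k, 0%N; split; last by rewrite /= /Y kE.
  by rewrite /r; have [_ _ ->] := bp.
have tu : top_used (i + 1, j) by rewrite /top_used /= addrK.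
have next d : goes_up ((i + 1, j), d) ->
    (if d then left_used (i + 1, j) else bottom_used (i + 1, j)) ->
    exists k m, (k < r)%N /\ st k m = ((i, j), false).
  move=> up dused; have [|||k [m [kr E]]] := IH (i + 1, j) d _ _ dused; rewrite /=; try lia.
  by exists k, m.+1; split=> //=; rewrite E /nxt up /= addrK.
have jb' : j <= b%:Z by lia.
have [lu|lu] := boolP (left_used (i + 1, j)).
  by apply: (next true); rewrite ?/goes_up //= jb' tu.
have nS : (i + 1, j) \notin S.
  by apply/negP => /vertex_in[_ _ E3]; move: lu; rewrite -E3 tu.
have [E1 E2] := vertex_out nS; apply: (next false); last by rewrite E1.
by rewrite /goes_up /= E2 tu jb'.
Qed.

Lemma traced_paths_Z : Z a b traced_paths = S.
Proof.
apply/fsetP => /= p; rewrite /Z in_fset.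
have [pg|pg] := boolP (p \in grid a b); last first.
  transitivity false; first by move: (pg); rewrite !inE => /negbTE ->.
  by apply/esym/negbTE; apply: contra pg => /S_grid.
have -> : (p \in S) = (npaths_at traced_paths p != 1%N); last first.
  by move: pg; rewrite !inE => ->; rewrite /vacancy /osculation; lia.
have -> : npaths_at traced_paths p = count (fun k => p \in Q k) (iota 0 r).
  by rewrite /npaths_at /traced_paths count_map; apply: eq_count.
move: pg; rewrite mem_grid => pg.
have memQ k : (k < r)%N -> p \in Q k -> exists m, (st k m).1 = p.
  by move=> kr /mapP[m _ ->]; exists m.
have Qmem k m d : (k < r)%N -> st k m = (p, d) -> p \in Q k.
  move=> kr E; apply/mapP; exists m; last by rewrite E.
  by rewrite mem_iota /= add0n lt_len // E /=; lia.
have usedp k m : (k < r)%N -> (st k m).1 = p ->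
    if (st k m).2 then left_used p else bottom_used p.
  by move=> kr E; have [_ _ + _] := st_used m kr; rewrite E; apply; lia.
have pb1 : 1 <= p.1 <= a%:Z by lia.
have pb2 : 1 <= p.2 <= b%:Z by lia.
pose n := absz (p.2 + a%:Z - p.1)%R.
have pn : p.2 + a%:Z - p.1 = n%:Z by rewrite /n; lia.
have [pS|pS] := boolP (p \in S).
  apply/esym; have [E1 _ _] := vertex_in pS.
  have [lu|lu] := boolP (left_used p).
    have [k [m [kr E]]] := @covered n p true pb1 pb2 lu pn.
    have [|k' [m' [kr' E']]] := @covered n p false pb1 pb2 _ pn; first by rewrite E1.
    have pk := Qmem _ _ _ kr E; have pk' := Qmem _ _ _ kr' E'.
    suff : (2 <= count (fun k => p \in Q k) (iota 0 r))%N by lia.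
    case: (ltngtP k k') => [kk|kk|kE].
    - by apply: (@count_iota_pair _ k k'); rewrite // kk.
    - by apply: (@count_iota_pair _ k' k); rewrite // kk.
    (* On a single walk the content fixes the time, so it cannot enter [p] from both sides. *)
    - have mm : m = m'.
        by have := st_content k m; have := st_content k' m'; rewrite E E' kE /=; lia.
      by move: E'; rewrite -kE -mm E.
  apply/eqP => c1; have /hasP[k] : has (fun k => p \in Q k) (iota 0 r) by rewrite has_count c1.
  rewrite mem_iota => kr /(memQ _ kr)[m E].
  by have := usedp _ _ kr E; rewrite E1 (negbTE lu); case: ifP.
have [E1 _] := vertex_out pS; apply/esym/negbTE; rewrite negbK eqn_leq; apply/andP; split.
  rewrite leqNgt; apply/negP => /count_iota_ge2[k [k' [kk /memQ pk /memQ pk']]].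
  have kr : (k < r)%N by lia.
  have k'r : (k' < r)%N by lia.
  have [m E] := pk kr; have [m' E'] := pk' k'r.
  have [d d'] := same_point kk (etrans E (esym E')).
  have := usedp _ _ kr E; have := usedp _ _ k'r E'.
  by rewrite d (negbTE d') E1 => /negbTE ->.
rewrite -has_count.
have [k [m [kr E]]] : exists k m, (k < r)%N /\ st k m = (p, left_used p).
  by apply: (@covered n p (left_used p) pb1 pb2 _ pn); case: ifP => // lu; rewrite E1 lu.
by apply/hasP; exists k; [rewrite mem_iota | apply: Qmem E].
Qed.

End ToPaths.

(** * The bijections *)

Section Ranges.
Local Open Scope ring_scope.

(** This removes the paths from the problem: only the vertex rule and the boundary bits of [S]
    remain. *)
Lemma VOSP a b alpha beta l S : BP a b alpha beta ->
  VOS a b alpha beta l S <-> vertex_set a b alpha beta S /\ #|` S| = l.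
Proof.
move=> bp; split=> [[P [opP <-] <-]|[vs <-]]; first by split=> //; apply: vertex_set_Z.
exists (traced_paths a b alpha beta S); last exact: traced_paths_Z bp vs.
by split; [apply: traced_paths_OP | rewrite (traced_paths_Z bp vs)].
Qed.

Lemma state_take w k c : (k < size w)%N ->
  state (take k.+1 w) c =
  state (take k w) c (+) ((nth 0 w k == c) || (nth 0 w k + 1 == c)).
Proof. by move=> kw; rewrite (take_nth 0) // state_rcons. Qed.

(** * The points of a generalized oscillating tableau lie in the rectangle *)

Section LexRange.
Variables (a b : nat) (t w : seq int).
Hypotheses (vw : valid w) (t_pos : forall k, (k < size w)%N -> 1 <= nth 0 t k <= a%:Z)
  (t_le : forall k, (k.+1 < size w)%N -> nth 0 t k < nth 0 t k.+1 \/
     nth 0 t k = nth 0 t k.+1 /\ nth 0 w k < nth 0 w k.+1)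
  (w_end : forall c, b%:Z - a%:Z < c -> state w c).

(** Forward induction with the invariant that all bits at positions up to [- t_k] are still 0. If
    [t] grows, a step further left would exchange two zeros; if not, the content grows. *)
Lemma lex_lower k : (k < size w)%N -> 1 - nth 0 t k <= nth 0 w k /\
  forall c, c <= - nth 0 t k -> state (take k.+1 w) c = false.
Proof.
elim: k => [|k IH] kw.
  have lb : 1 - nth 0 t 0 <= nth 0 w 0.
    by have := vw kw; have := t_pos kw; rewrite take0 !state_nil; lia.
  split=> // c ct; rewrite state_take // take0 state_nil.
  by have := t_pos kw; lia.
have [IH1 IH2] := IH (ltnW kw).
have lb : 1 - nth 0 t k.+1 <= nth 0 w k.+1.
  case: (t_le kw) => [tt|[<- ww]]; last by lia.
  rewrite leNgt; apply/negP => wt; have := vw kw.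
  by rewrite !IH2 ?eqxx //; lia.
split=> // c ct; rewrite state_take // IH2; first by lia.
by case: (t_le kw) => [tt|[tt _]]; lia.
Qed.

Lemma state_before k c : (k < size w)%N -> nth 0 w k + 1 < c ->
  state (take k w) c = state (take k.+1 w) c.
Proof. by move=> kw kc; rewrite state_take //; lia. Qed.

(** If both bits are 1 after the step, they were both 0 before it, and there was nothing to
    exchange. *)
Lemma step_le k d : (k < size w)%N ->
  (forall c, d < c -> state (take k.+1 w) c) -> nth 0 w k <= d.
Proof.
move=> kw after; rewrite leNgt; apply/negP => wd; have := vw kw.
have := after (nth 0 w k) ltac:(lia); have := after (nth 0 w k + 1) ltac:(lia).
by rewrite !state_take // !eqxx orbT /= !addbT => /negbTE-> /negbTE->.
Qed.

(** Backward induction from the final state, [n] being the number of steps after [k]. Step [k]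
    touches no position beyond [b - t_k + 1], so the ones from [b - t_k + 2] on are already there
    before it. *)
Lemma lex_upper n k : (k + n.+1)%N = size w ->
  nth 0 w k <= b%:Z - nth 0 t k /\
  forall c, b%:Z - nth 0 t k + 2 <= c -> state (take k w) c.
Proof.
elim: n k => [|n IH] k kE; have kw : (k < size w)%N by lia.
all: have := t_pos kw => tk.
  have after c : b%:Z - nth 0 t k < c -> state (take k.+1 w) c.
    have -> : k.+1 = size w by lia.
    by move=> tc; rewrite take_size; apply: w_end; lia.
  have ub := step_le kw after.
  by split=> // c ct; rewrite state_before //; [apply: after | ]; lia.
have kw' : (k.+1 < size w)%N by lia.
have [IH1 IH2] := IH k.+1 ltac:(lia).
have ub : nth 0 w k <= b%:Z - nth 0 t k.
  case: (t_le kw') => [tt|[-> ww]]; last by lia.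
  by apply: (step_le kw) => c ct; apply: IH2; lia.
split=> // c ct; rewrite state_before //; last by lia.
by apply: IH2; case: (t_le kw') => [tt|[<- _]]; lia.
Qed.

Lemma lex_range k : (k < size w)%N -> 1 <= nth 0 t k + nth 0 w k <= b%:Z.
Proof.
move=> kw; have [lb _] := lex_lower kw.
by have [ub _] := @lex_upper (size w - k).-1 k ltac:(lia); lia.
Qed.

End LexRange.

(** Index [c] is the half-diagonal [c - 1/2], whose negative has index [1 - c]; the initial bits at
    the two are complementary. *)
Lemma state_mirror w c : state (map -%R w) c = ~~ state w (1 - c).
Proof.
rewrite /state count_map -addNb; congr (_ (+) odd _); first by lia.
by apply: eq_count => x /=; lia.
Qed.

Lemma valid_mirror w : valid w -> valid (map -%R w).
Proof.
move=> vw k; rewrite size_map => kw; have := vw k kw.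
rewrite -map_take !state_mirror (nth_map 0) //.
have -> : 1 - - nth 0 w k = nth 0 w k + 1 by lia.
have -> : 1 - (- nth 0 w k + 1) = nth 0 w k by lia.
by rewrite (inj_eq negb_inj) eq_sym.
Qed.

(** Negating the contents turns decreasing into increasing ones, so [lex_range] applies with [a] and
    [b] exchanged. *)
Lemma antilex_range a b t w k : valid w ->
  (forall k, (k < size w)%N -> 1 <= nth 0 t k <= b%:Z) ->
  (forall k, (k.+1 < size w)%N -> nth 0 t k < nth 0 t k.+1 \/
     nth 0 t k = nth 0 t k.+1 /\ nth 0 w k > nth 0 w k.+1) ->
  (forall c, c <= b%:Z - a%:Z -> state w c = false) ->
  (k < size w)%N -> 1 <= nth 0 t k - nth 0 w k <= a%:Z.
Proof.
move=> vw t_pos t_le w_end kw; rewrite -(nth_map 0 0 -%R) //.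
apply: (@lex_range b a t (map -%R w)); rewrite ?size_map //.
- exact: valid_mirror.
- move=> j jw; rewrite !(nth_map 0) ?(ltnW jw) //.
  by case: (t_le j jw) => [tt|[tt ww]]; [left | right; rewrite ltrN2].
- by move=> c ca; rewrite state_mirror w_end //; lia.
Qed.

Lemma target_rows a b alpha c : b%:Z - a%:Z < c -> target a b (segment a) alpha c.
Proof.
move=> bc; rewrite /target; do 2 (case: ifP => [|_]; first by lia).
by case: ifP => // cb; rewrite mem_segment; lia.
Qed.

Lemma target_columns a b beta c : c <= b%:Z - a%:Z ->
  target a b beta (segment b) c = false.
Proof.
move=> bc; rewrite /target; case: ifP => // ca; rewrite ifT // mem_segment.
by apply/negbTE; rewrite negbK; lia.
Qed.

End Ranges.

(** * The bijection for an abstract ordering pair *)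

Section Bijection.
Local Open Scope ring_scope.
Variables (O : ordering_pair) (point : int -> int -> int * int).
Let L := op_L O.
Let prec := op_prec O.
Let plt := pair_lt L prec.
(** [point] inverts the pair formed by [L] and the content. On equal or neighbouring diagonals the
    order has to be the coordinatewise one, since only such pairs of points influence each other's
    bits. *)
Hypotheses (L_point : forall t w, L (point t w) = t)
  (content_point : forall t w, content (point t w) = w)
  (pointK : forall p, point (L p) (content p) = p)
  (pltP : forall p q : int * int, p != q ->
     content q - 1 <= content p <= content q + 1 ->
     plt p q = (p.1 <= q.1) && (p.2 <= q.2)).

Let plt_irr : irreflexive plt.
Proof. by move=> p; rewrite /plt /pair_lt ltxx eqxx; exact: op_prec_irr. Qed.

Let plt_trans : transitive plt.
Proof.
move=> q p r; rewrite /plt /pair_lt.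
move=> /orP[pq|/andP[/eqP-> pq]] /orP[qr|/andP[/eqP<- qr]].
- by rewrite (lt_trans pq qr).
- by rewrite pq.
- by rewrite qr.
- by rewrite eqxx /= (op_prec_trans pq qr : prec _ _) orbT.
Qed.

Let plt_total p q : p != q -> plt p q || plt q p.
Proof.
move=> pq; rewrite /plt /pair_lt; case: (ltgtP (L p) (L q)) => //= Lpq.
have : content p != content q.
  by apply: contra pq => /eqP cE; rewrite -(pointK p) -(pointK q) Lpq cE.
exact: op_prec_total.
Qed.

(** [S] is sorted by the reflexive closure of [plt]; without repetitions the result is strictly
    sorted. *)
Lemma progressionP (S : {fset int * int}) :
  perm_eq (progression O S) S /\ sorted plt (progression O S).
Proof.
apply: (@xgetPex _ [::] [set s | perm_eq s S /\ sorted plt s]%classic).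
pose leT p q := (p == q) || plt p q.
have leT_total : total leT.
  by move=> p q; rewrite /leT eq_sym; case: eqVneq => // /plt_total; rewrite orbC.
have leT_trans : transitive leT.
  move=> q p s /orP[/eqP->//|pq] /orP[/eqP<-|qs]; first by rewrite /leT pq orbT.
  by rewrite /leT (plt_trans pq qs) orbT.
exists (sort leT S); split; first by rewrite perm_sort.
have : pairwise leT (sort leT S) by rewrite -sorted_pairwise // sort_sorted.
have : uniq (sort leT S) by rewrite sort_uniq fset_uniq.
rewrite uniq_pairwise => u l; have := conj u l; move/andP; rewrite -pairwise_relI => ul.
apply: pairwise_sorted; apply: sub_pairwise ul => p q /= /andP[pq].
by rewrite /leT (negbTE pq).
Qed.

Lemma progression_unique (S : {fset int * int}) s :
  sorted plt s -> s =i S -> progression O S = s.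
Proof.
move=> ss sS; have [ps pss] := progressionP S.
apply: (irr_sorted_eq plt_trans plt_irr) => // p.
by rewrite (perm_mem ps) sS.
Qed.

(** * Reading a set of points in the given order *)

Section Reading.
Variables (S : {fset int * int}) (s : seq (int * int)).
Hypotheses (sS : perm_eq s S) (s_sorted : sorted plt s).
Let w := [seq content p | p <- s].

(** [A] selects only points that precede the [k]-th one, so counting it over [S] is counting it over
    the prefix read so far. *)
Let prefix_count k (A : pred (int * int)) (B : pred int) : (k < size s)%N ->
  (forall q, q != nth (0, 0) s k -> plt q (nth (0, 0) s k) -> B (content q) = A q) ->
  (forall q, A q -> q != nth (0, 0) s k /\ plt q (nth (0, 0) s k)) ->
  count B (take k w) = count A S.
Proof.
move=> ks AB Alt; rewrite -(permP sS) -[in RHS](cat_take_drop k s) count_cat.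
have lt_nth i j : (i < j < size s)%N -> plt (nth (0, 0) s i) (nth (0, 0) s j).
  by move=> /andP[ij js]; apply: (sorted_ltn_nth plt_trans) => //; apply: ltn_trans js.
rewrite -map_take count_map [X in (_ + X)%N](@eq_in_count _ _ pred0) ?count_pred0 ?addn0.
  apply: eq_in_count => q /(nthP (0, 0))[i]; rewrite size_take ks => ik.
  rewrite nth_take // => <- /=; have ltk := lt_nth i k ltac:(lia).
  by apply: AB => //; apply/eqP => E; rewrite E plt_irr in ltk.
move=> q /(nthP (0, 0))[i]; rewrite size_drop nth_drop => ik <- /=.
apply/negbTE/negP => /Alt[_].
have [->|i0] := posnP i; first by rewrite addn0 plt_irr.
have /lt_nth lt1 : (k < k + i < size s)%N.
  by move: ik; rewrite ltn_subRL => ->; rewrite andbT -[X in (X < _)%N]addn0 ltn_add2l.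
move=> lt2.
by have := plt_trans lt1 lt2; rewrite plt_irr.
Qed.

(** On the two diagonals next to the left edge of [p], the points read before [p] are exactly those
    that precede this edge, by [pltP]. *)
Lemma state_right_bit k : (k < size s)%N -> let p := nth (0, 0) s k in
  state (take k w) (content p) = right_bit S (p.1, p.2 - 1).
Proof.
move=> ks p; rewrite /state /right_bit; congr (_ (+) odd _).
  by rewrite /content /=; lia.
apply: prefix_count => // q; rewrite -/p.
  move=> qp; case: (boolP (content q - 1 <= content p <= content q + 1)) => [cq|cq].
    rewrite pltP //; last by lia.
    move=> /andP[q1 q2]; move: qp cq q1 q2; case: (q) => i j; case: (p) => i' j'.
    by rewrite xpair_eqE /content /=; lia.
  by move: cq; rewrite /content /=; lia.
move=> /and3P[q1 q2 qc]; have qp : q != p by apply/eqP => E; move: q2; rewrite E /=; lia.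
by split=> //; rewrite pltP //; move: q1 q2 qc; rewrite /content /=; lia.
Qed.

Lemma state_bottom_bit k : (k < size s)%N -> let p := nth (0, 0) s k in
  state (take k w) (content p + 1) = bottom_bit S (p.1 - 1, p.2).
Proof.
move=> ks p; rewrite /state /bottom_bit; congr (_ (+) odd _).
  by rewrite /content /=; lia.
apply: prefix_count => // q; rewrite -/p.
  move=> qp; case: (boolP (content q - 1 <= content p <= content q + 1)) => [cq|cq].
    rewrite pltP //; last by lia.
    move=> /andP[q1 q2]; move: qp cq q1 q2; case: (q) => i j; case: (p) => i' j'.
    by rewrite xpair_eqE /content /=; lia.
  by move: cq; rewrite /content /=; lia.
move=> /and3P[q1 q2 qc]; have qp : q != p by apply/eqP => E; move: q1; rewrite E /=; lia.
by split=> //; rewrite pltP //; move: q1 q2 qc; rewrite /content /=; lia.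
Qed.

Lemma valid_reading : valid w <->
  (forall p, p \in S -> right_bit S (p.1, p.2 - 1) != bottom_bit S (p.1 - 1, p.2)).
Proof.
split=> [vw p|H k].
  rewrite -(perm_mem sS) => /(nthP (0, 0))[k ks <-].
  rewrite -state_right_bit // -state_bottom_bit //.
  by have := vw k; rewrite size_map (nth_map (0, 0)) //; apply.
rewrite size_map => ks; rewrite (nth_map (0, 0)) // state_right_bit // state_bottom_bit //.
by apply: H; rewrite -(perm_mem sS) mem_nth.
Qed.

Lemma state_reading : state [seq content q | q <- S] =1 state w.
Proof.
by move=> c; rewrite /state !count_map (permP sS).
Qed.

End Reading.

(** * Mutually inverse maps *)

Section Main.
Variables (a b n l : nat) (alpha beta : {fset int}).
(** [point_grid] is the step that depends on [alpha] or [beta] being full; it is supplied separately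
    in the two cases. *)
Hypotheses (bp : BP a b alpha beta)
  (L_grid : forall p, p \in grid a b -> L p \in segment n)
  (point_grid : forall t w, valid w -> size t = size w ->
     {subset t <= mem (segment n)} ->
     (forall k, (k.+1 < size w)%N -> nth 0 t k < nth 0 t k.+1 \/
        nth 0 t k = nth 0 t k.+1 /\ prec (nth 0 w k) (nth 0 w k.+1)) ->
     (forall c, state w c = target a b alpha beta c) ->
     forall k, (k < size w)%N -> point (nth 0 t k) (nth 0 w k) \in grid a b).

Let lam := lambda_of a b alpha beta.
Let Psi (te : seq int * seq (seq nat)) : {fset int * int} :=
  [fset point x.1 x.2 | x in zip te.1 (profile te.2)]%fset.

Let Theta_GOT S : VOS a b alpha beta l S ->
  GOT (mem (segment n)) prec lam l (Theta O a b alpha beta S) /\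
  Psi (Theta O a b alpha beta S) = S.
Proof.
move=> /(VOSP _ _ bp)[[Sg vs st] Sl]; have [ps ss] := progressionP S.
have sl : size (progression O S) = l by rewrite -Sl; apply: perm_size.
rewrite /Theta; set s := progression O S in ps ss sl *.
have vw := (valid_reading ps ss).2 vs.
have [|ot pe] := @tableau_of_profileP lam [seq content p | p <- s] vw (lambda_of_part bp).
  by move=> c; rewrite (maya_lambda_of bp) -st; apply: (state_reading ps).
rewrite size_map sl in ot; split.
  split; rewrite /= ?size_map //.
    move=> x /mapP[p ps' ->]; apply: L_grid; apply: Sg.
    by rewrite -(perm_mem ps).
  move=> k kl; rewrite pe !(nth_map (0, 0)) ?sl ?(ltnW kl) //.
  have := (sortedP (0, 0) ss) k; rewrite sl => /(_ kl).
  by move=> /orP[|/andP[/eqP]]; [left | right].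
apply/fsetP => p; rewrite /Psi /= pe zip_map -(perm_mem ps).
apply/imfsetP/idP => /= [[x /mapP[q qs ->] ->]|pS]; first by rewrite /= pointK.
by exists (L p, content p); rewrite ?pointK //; apply/mapP; exists p.
Qed.

Let Psi_VOS te : GOT (mem (segment n)) prec lam l te ->
  VOS a b alpha beta l (Psi te) /\ Theta O a b alpha beta (Psi te) = te.
Proof.
case: te => t eta [/= szt tT ot ord]; have [szw vw st] := OT_state ot.
set w := profile eta in szw vw st ord *.
have wt c : state w c = target a b alpha beta c.
  have [_ _ _ el _] := ot.
  by rewrite -(maya_lambda_of bp) -/lam -el st // -szw take_size.
pose s := [seq point x.1 x.2 | x <- zip t w].
have szs : size s = l by rewrite size_map size_zip szt szw minnn.
have nth_s k : (k < l)%N -> nth (0, 0) s k = point (nth 0 t k) (nth 0 w k).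
  by move=> kl; rewrite (nth_map (0, 0)) ?size_zip ?szt ?szw ?minnn // nth_zip ?szt ?szw.
(* The defining condition on [t] and the profile is exactly strict sortedness of the points, so [s]
   is the progression of its own set of points. *)
have ss : sorted plt s.
  apply/(sortedP (0, 0)) => k; rewrite szs => kl; rewrite !nth_s ?(ltnW kl) //.
  rewrite /plt /pair_lt !L_point !content_point.
  by case: (ord k kl) => [->//|[-> ->]]; rewrite eqxx orbT.
have sL : [seq L p | p <- s] = t.
  rewrite -map_comp (eq_map (g := fst)) => [|x /=]; last exact: L_point.
  by rewrite -[LHS]/(unzip1 _) unzip1_zip ?szt ?szw.
have sw : [seq content p | p <- s] = w.
  rewrite -map_comp (eq_map (g := snd)) => [|x /=]; last exact: content_point.
  by rewrite -[LHS]/(unzip2 _) unzip2_zip ?szt ?szw.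
have sE : s =i Psi (t, eta).
  move=> p; apply/mapP/imfsetP => /= -[x xs ->]; by exists x.
(* Strict sorting makes the [l] points distinct, so the set has [l] elements. *)
have us : uniq s by apply: (sorted_uniq plt_trans plt_irr).
have ps : perm_eq s (Psi (t, eta)) by apply: uniq_perm => //; apply: fset_uniq.
split.
  apply/(VOSP _ _ bp); split; last by rewrite -szs; apply/esym/perm_size.
  split.
  - move=> p; rewrite -sE => /(nthP (0, 0))[k]; rewrite szs => kl <-.
    by rewrite nth_s //; apply: point_grid => //; rewrite ?szt ?szw.
  - by apply/(valid_reading ps ss); rewrite sw.
  - by move=> c; rewrite (state_reading ps) sw.
rewrite /Theta (progression_unique ss sE) sL sw.
by rewrite (tableau_of_profileK ot).
Qed.

Lemma Theta_bijection : bij_with_inverse (VOS a b alpha beta l)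
  (GOT (mem (segment n)) prec lam l) (Theta O a b alpha beta) Psi.
Proof.
split.
- split.
  + by move=> S /Theta_GOT[].
  + move=> S S'; rewrite !inE => /Theta_GOT[_ SE] /Theta_GOT[_ SE'] E.
    by rewrite -SE -SE' E.
  + by move=> te /Psi_VOS[V E]; exists (Psi te).
- by move=> te /Psi_VOS[].
- by move=> S /Theta_GOT[].
- by move=> te /Psi_VOS[].
Qed.

End Main.
End Bijection.

(** * The lexicographic and antilexicographic pairs *)

Section Cases.
Local Open Scope ring_scope.

Lemma Theta_lex_bijection a b beta l : BP a b (segment a) beta ->
  bij_with_inverse (VOS a b (segment a) beta l)
    (GOT (mem (segment a)) <%R (lambda_of a b (segment a) beta) l)
    (Theta lex_pair a b (segment a) beta) Psi_lex.
Proof.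
move=> bp.
apply: (@Theta_bijection lex_pair (fun t w => (t, t + w))) => //=.
- by move=> t w; rewrite /content /=; lia.
- by move=> [i j]; rewrite /content /=; congr (_, _); lia.
- by move=> [i j] [i' j']; rewrite xpair_eqE /pair_lt /content /=; lia.
- by move=> p; rewrite mem_grid mem_segment => /andP[].
move=> t w vw tw tT ord wt k kw; have ta j : (j < size w)%N -> 1 <= nth 0 t j <= a%:Z.
  by move=> jw; rewrite -mem_segment; apply: tT; rewrite mem_nth ?tw.
rewrite mem_grid ta //=; apply: (lex_range (a := a)) => //.
(* With [alpha] all of [[a]], every bit on the right side is 1. *)
by move=> c ca; rewrite wt target_rows.
Qed.

Lemma Theta_antilex_bijection a b alpha l : BP a b alpha (segment b) ->
  bij_with_inverse (VOS a b alpha (segment b) l)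
    (GOT (mem (segment b)) >%R (lambda_of a b alpha (segment b)) l)
    (Theta antilex_pair a b alpha (segment b)) Psi_antilex.
Proof.
move=> bp.
apply: (@Theta_bijection antilex_pair (fun t w => (t - w, t))) => //=.
- by move=> t w; rewrite /content /=; lia.
- by move=> [i j]; rewrite /content /=; congr (_, _); lia.
- by move=> [i j] [i' j']; rewrite xpair_eqE /pair_lt /content /=; lia.
- by move=> p; rewrite mem_grid mem_segment => /andP[].
move=> t w vw tw tT ord wt k kw; have tb j : (j < size w)%N -> 1 <= nth 0 t j <= b%:Z.
  by move=> jw; rewrite -mem_segment; apply: tT; rewrite mem_nth ?tw.
rewrite mem_grid /= tb // andbT; apply: (antilex_range (b := b)) => //.
(* With [beta] all of [[b]], every bit on the lower side is 0. *)
by move=> c ca; rewrite wt target_columns.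
Qed.

End Cases.

Theorem theorem16 (a b : nat) (alpha beta : {fset int}) (l : nat)
    (a_gt0 : (0 < a)%N) (b_gt0 : (0 < b)%N) (bp : BP a b alpha beta) :
  (alpha = segment a ->
     bij_with_inverse
       (VOS a b (segment a) beta l)
       (GOT (mem (segment a)) <%R (lambda_of a b (segment a) beta) l)
       (Theta lex_pair a b (segment a) beta)
       Psi_lex) /\
  (beta = segment b ->
     bij_with_inverse
       (VOS a b alpha (segment b) l)
       (GOT (mem (segment b)) >%R (lambda_of a b alpha (segment b)) l)
       (Theta antilex_pair a b alpha (segment b))
       Psi_antilex).
Proof.
split=> [alphaE|betaE].
- by apply: Theta_lex_bijection; rewrite -alphaE.
- by apply: Theta_antilex_bijection; rewrite -betaE.
Qed.
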